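(* Let $S$ be a bounded subset of $E$ such that, for any $\gamma^*\in\Gamma_F^*$, the intersection $P_{\gamma^*}\cap S$ is an open, Jordan measurable subset of $P_{\gamma^*}$. Then $$n_\varepsilon(S)\sim \frac{\varepsilon^{-q}}{\mathrm{vol}(V^\bot/\Gamma^\bot)}\sum_{\gamma^*\in\Gamma_F^*}\mathrm{vol}_{n-r}(P_{\gamma^*}\cap S),\qquad \varepsilon\to 0.$$
   Context: $E$ is a finite-dimensional real vector space with inner product $(\cdot,\cdot)$, $n=\dim E$; $F\subset E$ is a $p$-dimensional linear subspace and $H=F^\bot$ its orthogonal complement, of dimension $q$, $p+q=n$. For $\varepsilon>0$, $T_\varepsilon:E\to E$ is the linear map with $T_\varepsilon(x)=x$ for $x\in F$ and $T_\varepsilon(x)=\varepsilon^{-1}x$ for $x\in H$. $\Gamma\subset E$ is a (full rank) lattice. For a bounded set $S\subset E$, $n_\varepsilon(S)=\#(T_\varepsilon(S)\cap\Gamma)$. $\Gamma^*=\{\gamma^*\in E:(\gamma^*,\Gamma)\subset\mathbb Z\}$ is the dual lattice of $\Gamma$; $\Gamma_F=\Gamma^*\cap F$; $V$ is the linear span of $\Gamma_F$ in $E$, $r=\dim V$. $\Gamma_F$ is a lattice in $V$, and $\Gamma_F^*=\{x\in V:(x,\Gamma_F)\subset\mathbb Z\}\subset V$ is its dual lattice in $V$. $V^\bot$ is the orthogonal complement of $V$ in $E$, and $\Gamma^\bot=\Gamma\cap V^\bot$, which is a lattice in $V^\bot$. For $x\in V$, $P_x=x+V^\bot$ is the $(n-r)$-dimensional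 affine subspace through $x$ orthogonal to $V$. $\mathrm{vol}_{n-r}$ is Euclidean volume on $P_{\gamma^*}$, and $\mathrm{vol}(V^\bot/\Gamma^\bot)$ is the covolume of $\Gamma^\bot$ in $V^\bot$. The notation $f\sim g$ as $\varepsilon\to0$ means $f=g\,(1+o(1))$. *)

(* Defs.v *)
From HB Require Import structures.
From mathcomp Require Import all_boot all_order all_algebra.
From mathcomp Require Import finmap.
From mathcomp Require Import all_classical all_reals all_analysis.

Set Implicit Arguments.
Unset Strict Implicit.
Unset Printing Implicit Defensive.

Import Order.TTheory GRing.Theory Num.Theory.
Import numFieldNormedType.Exports.

Local Open Scope classical_set_scope.
Local Open Scope ring_scope.

Section JordanContent.
Context {R : realType} {d : nat}.
Implicit Types A : set 'rV[R]_d.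

Definition box (a b : 'rV[R]_d) : set 'rV[R]_d :=
  [set t | forall i, a 0 i <= t 0 i < b 0 i].

Definition box_vol (a b : 'rV[R]_d) : R := \prod_(i < d) (b 0 i - a 0 i).

(* In dimension 0 there is a single box, the point, and its volume is 1. *)
Definition outer_content A : R :=
  inf [set v | exists (m : nat) (a b : 'I_m -> 'rV[R]_d),
    [/\ forall k i, a k 0 i <= b k 0 i,
        A `<=` \bigcup_k box (a k) (b k) &
        v = \sum_(k < m) box_vol (a k) (b k)]].

Definition inner_content A : R :=
  sup [set v | exists (m : nat) (a b : 'I_m -> 'rV[R]_d),
    [/\ forall k i, a k 0 i <= b k 0 i,
        trivIset setT (fun k => box (a k) (b k)),
        \bigcup_k box (a k) (b k) `<=` A &
        v = \sum_(k < m) box_vol (a k) (b k)]].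

Definition jordan_measurable A : Prop :=
  (exists a b, A `<=` box a b) /\ inner_content A = outer_content A.

End JordanContent.

Section EuclideanSpace.
Context {R : realType} {E : vectType R} (dot : {dot E for idfun}).
Implicit Types (U F : {vspace E}) (L S : set E).

Definition bounded_for S : Prop := exists M : R, forall x, S x -> dot x x <= M.

Definition onb U : (\dim U).-tuple E :=
  xget (vbasis U) [set e : (\dim U).-tuple E | basis_of U e && orthonormal dot e].

(* Isometric coordinates on the affine subspace x + U.  The notions below do
   not depend on the orthonormal basis picked by onb. *)
Definition chart U (x : E) (t : 'rV[R]_(\dim U)) : E :=
  x + \sum_(i < \dim U) t 0 i *: (onb U)`_i.
Arguments chart : clear implicits.

(* These three speak of the set (x + U) `&` S as a subset of x + U. *)
Definition open_in U (x : E) S : Prop := open (chart U x @^-1` S).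

Definition jordan_measurable_in U (x : E) S : Prop :=
  jordan_measurable (chart U x @^-1` S).

Definition vol_in U (x : E) S : R := outer_content (chart U x @^-1` S).

Definition lattice_basis U L (b : (\dim U).-tuple E) : Prop :=
  basis_of U b /\
  L = [set y | exists z : 'I_(\dim U) -> int, y = \sum_(i < \dim U) b`_i *~ z i].

Definition is_lattice U L : Prop := exists b : (\dim U).-tuple E, lattice_basis L b.

Definition fund_domain U (b : (\dim U).-tuple E) : set E :=
  [set y | exists t : 'I_(\dim U) -> R,
    (forall i, 0 <= t i < 1) /\ y = \sum_(i < \dim U) t i *: b`_i].

(* The covolume of a lattice L in U: volume of a fundamental parallelepiped,
   which is the same for all Z-bases of L. *)
Definition covol U L : R :=
  vol_in U 0 (fund_domain (xget (vbasis U) [set b | lattice_basis L b])).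

Definition dual_in U L : set E :=
  [set x | x \in U /\ forall y, L y -> dot x y \is a Num.int].

Definition is_lspan S U : Prop :=
  S `<=` [set` U] /\ forall W : {vspace E}, S `<=` [set` W] -> (U <= W)%VS.

Lemma is_lspan_exists S : exists U, is_lspan S U.
Proof.
pose P n := `[< exists2 W : {vspace E}, S `<=` [set` W] & \dim W = n >].
have exP : exists n, P n.
  by exists (\dim {:E}); apply/asboolP; exists fullv => // x _ /=; rewrite memvf.
case: (ex_minnP exP) => n /asboolP[U SU dU] minU; exists U; split=> // W SW.
have SUW : S `<=` [set` (U :&: W)%VS].
  by move=> x Sx /=; rewrite memv_cap; apply/andP; split; [exact: SU|exact: SW].
have le_n : (n <= \dim (U :&: W))%N.
  by apply: minU; apply/asboolP; exists (U :&: W)%VS.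
by apply/capv_idPl/eqP; rewrite eqEdim capvSl dU.
Qed.

Definition lspan S : {vspace E} := projT1 (cid (is_lspan_exists S)).

Definition dilation F (eps : R) (x : E) : E :=
  daddv_pi F (orthov dot F) x + eps^-1 *: daddv_pi (orthov dot F) F x.

Lemma cap_orthov F : (F :&: orthov dot F = 0)%VS.
Proof.
apply/eqP; rewrite -subv0; apply/subvP => x; rewrite memv_cap memv0.
case/andP=> xF /mem_orthovP/(_ _ xF) x0; apply/negPn/negP => xn0.
by have := @neq0_dnorm_gt0 _ _ _ dot _ xn0; rewrite x0 ltxx.
Qed.

Lemma dilation_id F eps x : x \in F -> dilation F eps x = x.
Proof.
move=> xF; rewrite /dilation (daddv_pi_id (cap_orthov F) xF).
have /eqP := daddv_pi_add (cap_orthov F) (subvP (addvSl F (orthov dot F)) _ xF).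
rewrite (daddv_pi_id (cap_orthov F) xF) -subr_eq0 addrC addKr => /eqP ->.
by rewrite scaler0 addr0.
Qed.

Lemma dilation_orthov F eps x :
  x \in orthov dot F -> dilation F eps x = eps^-1 *: x.
Proof.
move=> xH; have capHF : (orthov dot F :&: F = 0)%VS by rewrite capvC cap_orthov.
have /eqP := daddv_pi_add (cap_orthov F) (subvP (addvSr F (orthov dot F)) _ xH).
rewrite /dilation (daddv_pi_id capHF xH) -subr_eq0 addrK => /eqP ->.
by rewrite add0r.
Qed.

(* fset_set is the finite set underlying a finite set; the set here is finite
   as soon as S is bounded and Gamma is a lattice. *)
Definition lattice_count F (Gamma S : set E) (eps : R) : nat :=
  #|` fset_set (dilation F eps @` S `&` Gamma)|.

Definition dual_section F (Gamma : set E) : set E :=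
  dual_in fullv Gamma `&` [set` F].

End EuclideanSpace.

Arguments chart {R E} dot U x t.

(* Main.v *)
Require Import Defs.
From mathcomp Require Import all_boot all_order all_algebra.
From mathcomp Require Import finmap.
From mathcomp Require Import ring lra.
From mathcomp Require Import all_classical all_reals all_analysis.
Set Implicit Arguments.
Unset Strict Implicit.
Unset Printing Implicit Defensive.
Import Order.TTheory GRing.Theory Num.Theory.
Import numFieldNormedType.Exports.
Local Open Scope classical_set_scope.
Local Open Scope ring_scope.

(** The dilation fixes V, which lies in F, and dilation x - x always lies in
    H, which is orthogonal to V.  So a point of Gamma and its preimage under
    the dilation have the same projection g on V, and g belongs to the dual
    of Gamma_F.  The count splits into a sum over g, and S being bounded only
    finitely many g contribute (dual_section_finite).  What remains is one
    asymptotic count for each g.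

    Fix g.  The points of Gamma above g form a coset of the lattice
    Gamma_perp in V_perp: it is not empty (fiber_nonempty) because Gamma has
    a basis whose dual basis begins with a basis of Gamma_F (adapted_bases,
    from the Smith normal form).  Pulled back by the dilation, this coset
    becomes a coset of the lattice obtained from Gamma_perp by contracting
    the directions of H by eps and keeping those of F.  Its covolume is
    eps ^ q times that of Gamma_perp, so the claim is that it becomes
    equidistributed in the Jordan measurable slice of S.

    Equidistribution needs only that the covering radius tends to 0.
    A discrete set having periods in every cube of side d has, up to errors
    controlled by d, as many points in any two boxes of equal sides.  It
    therefore has a density, with explicit upper and lower bounds on boxes
    (evenly_spread_exists), hence on finite unions of boxes, hence on Jordan
    measurable sets (jordan_cnt_near).

    That the covering radius tends to 0 is a transference argument.  If all
    nonzero vectors of the dual lattice are long, then the lattice is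
    everywhere within a small distance: one projects along an almost shortest
    dual vector and rounds one coordinate at a time, as in Babai's nearest
    plane algorithm (inhomogeneous_approx).  The dual of the contracted
    lattice is the dual of Gamma_perp with its H-components multiplied by
    1 / eps.  Since the latter meets F only in 0 (integral_on_section_eq0),
    each of its nonzero vectors is stretched to infinity, and only finitely
    many of them are short at the start (covering_contraction).

    The covolume is the Jordan content of a fundamental cell, and the theory
    of this content is obtained by counting too.  Counting a refined lattice
    in its own cell shows that the content of the cell is the inverse of the
    density (cell_content).  Counting the refinements of one lattice in the
    cell of another shows that the content of cells is multiplicative
    (cellvol_mul).  Hence it is invariant under conjugation, and contracting
    q directions multiplies it by eps ^ q, without reference to rotations or
    determinants. *)

(** * Cardinalities of finite sets *)

Definition cnt {T : choiceType} (X : set T) : nat := #|` fset_set X|.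

Lemma cnt_image_le {T U : choiceType} (f : T -> U) (A : set T) (B : set U) :
  finite_set B -> set_inj A f -> (forall x, A x -> B (f x)) ->
  finite_set A /\ (cnt A <= cnt B)%N.
Proof.
move=> fB injf AB.
have /unsquash g : $| {injfun A >-> B} | by apply/injfunPex; exists f.
have fA : finite_set A by apply: card_le_finite (inj_card_le g) fB.
split=> //; rewrite /cnt.
have <- : #|` [fset f x | x in fset_set A]%fset| = #|` fset_set A|.
  apply: card_in_imfset.
  by move=> x y /=; rewrite !in_fset_set //; exact: injf.
apply: fsubset_leq_card; apply/fsubsetP => y /imfsetP[x /= xA ->].
by move: xA; rewrite !in_fset_set // !inE => /AB.
Qed.

Lemma cnt_le {T : choiceType} (A B : set T) :
  finite_set B -> A `<=` B -> (cnt A <= cnt B)%N.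
Proof.
by move=> fB AB; have [] := @cnt_image_le _ _ id A B fB (fun x y _ _ => id) AB.
Qed.

Lemma cnt_image {T U : choiceType} (f : T -> U) (A : set T) :
  injective f -> finite_set A -> cnt (f @` A) = cnt A.
Proof. by move=> injf fA; rewrite /cnt fset_set_image // card_imfset. Qed.

Lemma cnt0 {T : choiceType} : cnt (set0 : set T) = 0%N.
Proof. by rewrite /cnt fset_set0. Qed.

Lemma cnt_cover {T : choiceType} {I : eqType} (s : seq I) (F : I -> set T)
    (A : set T) : (forall i, i \in s -> finite_set (F i)) ->
  (forall x, A x -> exists2 i, i \in s & F i x) ->
  (cnt A <= \sum_(i <- s) cnt (F i))%N.
Proof.
elim: s A => [|i s IH] A fF cov.
  rewrite big_nil leqn0; have -> : A = set0 by apply/seteqP; split=> x // /cov[].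
  by rewrite cnt0.
rewrite big_cons.
have fA : finite_set (A `\` F i).
  have : finite_set (\bigcup_(j in [set` s]) F j).
    apply: bigcup_finite => [|j js]; first exact: finite_seq.
    by apply: fF; rewrite inE js orbT.
  apply: sub_finite_set => x [Ax Fx]; have [j] := cov _ Ax.
  by rewrite inE => /orP[/eqP ->//|js Fj]; exists j.
have fi : finite_set (F i) by apply: fF; rewrite mem_head.
have fA' : finite_set A.
  apply: (@sub_finite_set _ _ (F i `|` A `\` F i)); last by rewrite finite_setU.
  by move=> x Ax; have [Fx|Fx] := pselect (F i x); [left|right].
apply: (@leq_trans (cnt (F i) + cnt (A `\` F i))%N); last first.
  rewrite leq_add2l; apply: IH => [j js|x [Ax Fx]].
    by apply: fF; rewrite inE js orbT.
  by have [j] := cov _ Ax; rewrite inE => /orP[/eqP ->//|js Fj]; exists j.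
rewrite /cnt -cardfsUI -fset_setU //; apply: leq_trans (leq_addr _ _).
apply: cnt_le; first by rewrite finite_setU.
by move=> x Ax; have [Fx|Fx] := pselect (F i x); [left|right].
Qed.

Lemma cnt_packing {T : choiceType} {I : eqType} (s : seq I) (F : I -> set T)
    (A : set T) : finite_set A -> uniq s ->
  (forall i, i \in s -> F i `<=` A) ->
  (forall i j x, i \in s -> j \in s -> F i x -> F j x -> i = j) ->
  (\sum_(i <- s) cnt (F i) <= cnt A)%N.
Proof.
elim: s A => [|i s IH] A fA; first by rewrite big_nil.
rewrite big_cons /= => /andP[iNs us] FA dF.
have fi : finite_set (F i) by apply: sub_finite_set fA; apply: FA; rewrite mem_head.
apply: (@leq_trans (cnt (F i) + cnt (A `\` F i))%N).
  rewrite leq_add2l; apply: IH => // [|j js x Fj|j k x js ks].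
  - exact: finite_setD.
  - split; first by apply: (FA j) => //; rewrite inE js orbT.
    move=> Fi; move: iNs; have -> : i = j.
      by apply: dF Fi Fj; rewrite inE ?js ?eqxx ?orbT.
    by rewrite js.
  - by apply: dF; rewrite inE ?js ?ks orbT.
have fD : finite_set (A `\` F i) by exact: finite_setD.
rewrite /cnt -cardfsUI -fset_setU // -fset_setI //.
rewrite setDIK fset_set0 cardfs0 addn0; apply: cnt_le => // x [|[]//].
by apply: FA; rewrite mem_head.
Qed.

(** * Integer points in a box *)

Section IntegerPoints.
Context {R : realType} {m : nat}.
Implicit Types (a b : 'rV[R]_m).

Lemma cnt_int_box (a b : 'I_m -> int) : (forall i, a i <= b i) ->
  finite_set [set z : 'rV[int]_m | forall i, a i <= z 0 i < b i] /\
  cnt [set z : 'rV[int]_m | forall i, a i <= z 0 i < b i] =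
    (\prod_i `|b i - a i|)%N.
Proof.
move=> ab; pose n i := `|b i - a i|%N.
pose f (j : {dffun forall i : 'I_m, 'I_(n i)}) : 'rV[int]_m := \row_i (a i + (j i)%:Z).
have finj : injective f.
  move=> j k /rowP fjk; apply/ffunP => i; apply: val_inj.
  by have := fjk i; rewrite !mxE => /addrI[].
have -> : [set z : 'rV[int]_m | forall i, a i <= z 0 i < b i] = f @` setT.
  apply/seteqP; split=> [z zab|_ [j _ <-] i]; last first.
    rewrite mxE lerDl lez_nat leq0n /= -ltrBrDl.
    rewrite -[b i - a i]gez0_abs ?subr_ge0 //.
    by rewrite ltz_nat ltn_ord.
  have H i : (`|z ord0 i - a i| < n i)%N.
    have /andP[az zb] := zab i.
    by rewrite -ltz_nat !gez0_abs ?subr_ge0 // ltrD2r.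
  exists [ffun i => Ordinal (H i)] => //.
  apply/rowP => i; rewrite !mxE ffunE /= gez0_abs ?subrKC //.
  by rewrite subr_ge0; have /andP[] := zab i.
split; first exact/finite_image/finite_finset.
rewrite /cnt fset_set_image; last exact: finite_finset.
rewrite card_imfset //= -/(fset_set _).
transitivity #|{dffun forall i : 'I_m, 'I_(n i)}|.
  rewrite -card_finset; congr #|` _|; apply/fsetP => j.
  rewrite in_fset_set; last first.
    by have := @finite_finset _ [set: {dffun forall i : 'I_m, 'I_(n i)}]; exact.
  by rewrite in_setT; apply/esym/imfsetP; exists j.
rewrite card_dep_ffun foldrE big_map enumT; apply: eq_bigr => i _.
by rewrite card_ord.
Qed.

Definition int_points a b : set 'rV[int]_m :=
  [set z | forall i, a 0 i <= (z 0 i)%:~R < b 0 i].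

Lemma int_pointsE a b : int_points a b =
  [set z | forall i, Num.ceil (a 0 i) <= z 0 i < Num.ceil (b 0 i)].
Proof.
apply/seteqP; split=> z zab i; have := zab i.
  by rewrite ceil_le_int ceil_gt_int.
by rewrite ceil_le_int ceil_gt_int.
Qed.

Lemma finite_int_points a b : finite_set (int_points a b).
Proof.
have [ab|nab] := pselect (forall i, Num.ceil (a 0 i) <= Num.ceil (b 0 i)).
  by rewrite int_pointsE; have [] := cnt_int_box ab.
suff -> : int_points a b = set0 by [].
rewrite int_pointsE; apply/seteqP; split=> // z zab; case: nab => i.
by have /andP[az /ltW zb] := zab i; exact: le_trans zb.
Qed.

Lemma ler_int_points a b : (forall i, a 0 i <= b 0 i) ->
  (cnt (int_points a b))%:R <= \prod_i (b 0 i - a 0 i + 1) :> R.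
Proof.
move=> ab; rewrite int_pointsE.
have ab' i : Num.ceil (a 0 i) <= Num.ceil (b 0 i) by apply: le_ceil.
have [_ ->] := cnt_int_box ab'; rewrite natr_prod; apply: ler_prod => i _.
rewrite ler0n /= natr_absz ger0_norm ?subr_ge0 // intrB.
have := ceilB1_lt (b 0 i); have := ceil_ge (a 0 i); rewrite intrB.
lra.
Qed.

Lemma ger_int_points a b : (forall i, 1 <= b 0 i - a 0 i) ->
  \prod_i (b 0 i - a 0 i - 1) <= (cnt (int_points a b))%:R :> R.
Proof.
move=> ab; rewrite int_pointsE.
have ab' i : Num.ceil (a 0 i) <= Num.ceil (b 0 i).
  by apply: le_ceil; have := ab i; lra.
have [_ ->] := cnt_int_box ab'; rewrite natr_prod; apply: ler_prod => i _.
rewrite subr_ge0 ab /= natr_absz ger0_norm ?subr_ge0 // intrB.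
have := ceilB1_lt (a 0 i); have := ceil_ge (b 0 i); rewrite intrB.
lra.
Qed.
End IntegerPoints.

(** * Periods and grids *)

Section Limits.
Context {R : realType}.

Lemma cvg_prodr {T : Type} {F : set_system T} {FF : Filter F} {I : Type}
    (r : seq I) (f : I -> T -> R) (l : I -> R) :
  (forall i, f i x @[x --> F] --> l i) ->
  \prod_(i <- r) f i x @[x --> F] --> \prod_(i <- r) l i.
Proof. by move=> fl; apply: cvg_big => //; exact: mul_continuous. Qed.

Lemma cvg_sumr {T : Type} {F : set_system T} {FF : Filter F} {I : Type}
    (r : seq I) (f : I -> T -> R) (l : I -> R) :
  (forall i, f i x @[x --> F] --> l i) ->
  \sum_(i <- r) f i x @[x --> F] --> \sum_(i <- r) l i.
Proof. by move=> fl; apply: cvg_big => //; exact: add_continuous. Qed.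

Lemma cvg_add_harmonic (a c : R) : a + c / n.+1%:R @[n --> \oo] --> a.
Proof.
rewrite -[X in _ --> X]addr0 -[X in _ --> _ + X](mulr0 c).
by apply: cvgD; [exact: cvg_cst|apply: cvgMr; exact: cvg_harmonic].
Qed.

End Limits.

Section Counting.
Context {R : realType} {m : nat}.
Implicit Types (a b c e t w y : 'rV[R]_m) (z : 'rV[int]_m) (X A : set 'rV[R]_m).

Definition locally_finite X := forall a b, finite_set (X `&` box a b).

(** The bound on the covering radius of a lattice, stated for sets that are not
    groups such as cosets: the periods of X meet every cube of side d. *)
Definition periodic_within (d : R) X := forall t, exists p : 'rV[R]_m,
  (forall i, t 0 i <= p 0 i <= t 0 i + d) /\ (forall y, X y -> X (y + p)).

(** A period moves the first box into the second one: the periods reach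
    every cube of side d, and d is the room left in each direction. *)
Lemma cnt_box_le (d : R) X a b c e : periodic_within d X -> locally_finite X ->
  (forall i, e 0 i - c 0 i + d <= b 0 i - a 0 i) ->
  (cnt (X `&` box c e) <= cnt (X `&` box a b))%N.
Proof.
move=> pX fX ceab; have [p [pt Xp]] := pX (a - c).
have [] // := @cnt_image_le _ _ (fun y : 'rV[R]_m => y + p) (X `&` box c e) _ (fX a b).
  by move=> y z _ _ /addIr.
move=> y [Xy cey]; split; first exact: Xp.
move=> i; have := ceab i; have := pt i; have := cey i; rewrite !mxE.
lra.
Qed.

Definition grid_cell (w : 'rV[R]_m) (z : 'rV[int]_m) : set 'rV[R]_m :=
  box (\row_i ((z 0 i)%:~R * w 0 i)) (\row_i (((z 0 i)%:~R + 1) * w 0 i)).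

Lemma grid_cellP w z y : (forall i, 0 < w 0 i) ->
  grid_cell w z y <-> z = \row_i Num.floor (y 0 i / w 0 i).
Proof.
move=> w0; split=> [zy|-> i].
  apply/rowP => i; rewrite mxE; apply/esym/floor_def.
  have := zy i; rewrite !mxE ler_pdivlMr // ltr_pdivrMr // intrD.
  by move=> /andP[-> ->].
rewrite !mxE -ler_pdivlMr // -ltr_pdivrMr // floor_le_tmp /=.
by rewrite -[1]/(1%:~R) -intrD floorD1_gt.
Qed.

Lemma grid_packing X A w (J : {fset 'rV[int]_m}) (N : R) :
  (forall i, 0 < w 0 i) -> finite_set (X `&` A) ->
  (forall z, z \in J -> X `&` grid_cell w z `<=` A) ->
  (forall z, z \in J -> N <= (cnt (X `&` grid_cell w z))%:R) ->
  (#|` J|)%:R * N <= (cnt (X `&` A))%:R.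
Proof.
move=> w0 fA JA JN.
have := @cnt_packing _ _ J (fun z => X `&` grid_cell w z) (X `&` A) fA (fset_uniq J).
set N' := (\sum_(z <- J) _)%N => H; apply: le_trans (_ : N'%:R <= _); last first.
  rewrite ler_nat; apply: H => [z zJ y [Xy zy]|z1 z2 y _ _].
    by split => //; apply: JA zJ _ _.
  by move=> [_ /grid_cellP -> //] [_ /grid_cellP -> //].
rewrite natr_sum (le_trans (_ : _ <= \sum_(z <- J) N)) //.
  by rewrite big_const_seq count_predT iter_addr_0 mulr_natl.
by rewrite [leLHS]big_seq [leRHS]big_seq; apply: ler_sum => z /JN.
Qed.

Lemma grid_covering X A w (J : {fset 'rV[int]_m}) (N : R) :
  locally_finite X ->
  (forall y, X y -> A y -> exists2 z, z \in J & grid_cell w z y) ->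
  (forall z, z \in J -> (cnt (X `&` grid_cell w z))%:R <= N) ->
  (cnt (X `&` A))%:R <= (#|` J|)%:R * N.
Proof.
move=> lX JA JN.
have := @cnt_cover _ _ J (fun z => X `&` grid_cell w z) (X `&` A).
move=> H; apply: le_trans (_ : (\sum_(z <- J) cnt (X `&` grid_cell w z))%:R <= _).
  rewrite ler_nat; apply: H => [z zJ|y [Xy Ay]]; first exact: lX.
  by have [z zJ zy] := JA y Xy Ay; exists z.
rewrite natr_sum (le_trans (_ : _ <= \sum_(z <- J) N)) //.
  by rewrite [leLHS]big_seq [leRHS]big_seq; apply: ler_sum => z /JN.
by rewrite big_const_seq count_predT iter_addr_0 mulr_natl.
Qed.
End Counting.

(** * The density of a periodic set *)

Section Density.
Context {R : realType} {m : nat}.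
Implicit Types (a b c e t w y : 'rV[R]_m) (X A : set 'rV[R]_m).

(** The density rho comes with an error given by enlarging or shrinking the
    sides of the box by d.  This form survives scaling with d and rho both
    rescaled, so that a single lattice yields arbitrarily fine evenly spread
    sets. *)
Definition evenly_spread (d rho : R) X :=
  [/\ locally_finite X,
      forall a b, (forall i, a 0 i <= b 0 i) ->
        (cnt (X `&` box a b))%:R <= rho * \prod_i (b 0 i - a 0 i + d) &
      forall a b, (forall i, d <= b 0 i - a 0 i) ->
        rho * \prod_i (b 0 i - a 0 i - d) <= (cnt (X `&` box a b))%:R].

(** Compares the counts in two boxes of unrelated shapes.  A large cube is
    packed with enlarged copies of one and covered by shrunken copies of the
    other; by periodicity every copy holds at least, respectively at most, as
    many points as the original.  The rounding of the numbers of copies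
    disappears as the cube grows. *)
Lemma cnt_box_cross (d : R) X a b c e : 0 < d ->
  locally_finite X -> periodic_within d X ->
  (forall i, d < b 0 i - a 0 i) -> (forall i, c 0 i <= e 0 i) ->
  (cnt (X `&` box c e))%:R * \prod_i (b 0 i - a 0 i - d) <=
  (cnt (X `&` box a b))%:R * \prod_i (e 0 i - c 0 i + d) :> R.
Proof.
move=> d0 fX pX ab ce.
have [u uE] : exists u : 'rV[R]_m, forall i, u 0 i = e 0 i - c 0 i + d.
  by exists (\row_i (e 0 i - c 0 i + d)) => i; rewrite mxE.
have [v vE] : exists v : 'rV[R]_m, forall i, v 0 i = b 0 i - a 0 i - d.
  by exists (\row_i (b 0 i - a 0 i - d)) => i; rewrite mxE.
have u0 i : 0 < u 0 i by rewrite uE; have := ce i; lra.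
have v0 i : 0 < v 0 i by rewrite vE; have := ab i; lra.
set N' := (cnt _)%:R; set N := (cnt _)%:R.
have key : N' * \prod_i (u 0 i)^-1 <= N * \prod_i (v 0 i)^-1.
  pose f (n : nat) := N' * \prod_i ((u 0 i)^-1 + (- 2) / n.+1%:R).
  pose g (n : nat) := N * \prod_i ((v 0 i)^-1 + 1 / n.+1%:R).
  apply: (@ler_cvg_to _ \oo _ R f g).
  - by apply: cvgMr; apply: cvg_prodr => i; exact: cvg_add_harmonic.
  - by apply: cvgMr; apply: cvg_prodr => i; exact: cvg_add_harmonic.
  near=> n.
  pose K : R := n.+1%:R.
  have K0 : 0 < K by rewrite ltr0n.
  have Ku i : 2 <= K / u 0 i.
    rewrite ler_pdivlMr //; suff : 2 * \sum_j u 0 j <= K.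
      apply: le_trans; rewrite ler_pM2l // (bigD1 i) //= lerDl.
      by apply: sumr_ge0 => j _; exact: ltW.
    rewrite /K (le_trans _ (_ : n%:R <= _)) ?ler_nat //.
    by near: n; exact: nbhs_infty_ger.
  set Big := box (0 : 'rV[R]_m) (const_mx K).
  (* K / u - 1 rather than K / u keeps the upper faces of the copies inside the
     large cube *)
  have low : (cnt (int_points 0 (\row_i (K / u 0 i - 1))))%:R * N' <=
      (cnt (X `&` Big))%:R.
    apply: (@grid_packing _ _ _ _ u) => //; first exact: fX.
      move=> z; rewrite in_fset_set; last exact: finite_int_points.
      rewrite inE => zJ y [_ yz] i; have := zJ i; have := yz i; rewrite !mxE.
      move=> /andP[y1 y2] /andP[z0 z1].
      rewrite (le_trans _ y1) ?mulr_ge0 ?(ltW (u0 i)) //= (lt_le_trans y2) //.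
      by rewrite -ler_pdivlMr // ltW // -ltrBrDr.
    move=> z zJ; rewrite ler_nat; apply: cnt_box_le (pX) (fX) _ => i.
    by rewrite !mxE -mulrBl ?uE ?vE; lra.
  have high : (cnt (X `&` Big))%:R <=
      (cnt (int_points 0 (\row_i (K / v 0 i))))%:R * N.
    apply: (@grid_covering _ _ _ _ v) => // [y Xy By|z zJ]; last first.
      rewrite ler_nat; apply: cnt_box_le (pX) (fX) _ => i.
      by rewrite !mxE -mulrBl ?uE ?vE; lra.
    exists (\row_i Num.floor (y 0 i / v 0 i)); last exact/grid_cellP.
    rewrite in_fset_set; last exact: finite_int_points.
    rewrite inE => i; have := By i; rewrite !mxE => /andP[y0 yK].
    rewrite ler0z floor_ge0 divr_ge0 ?(ltW (v0 i)) //=.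
      rewrite (le_lt_trans (floor_le _)) // ltr_pM2r ?invr_gt0 //.
  rewrite /f /g -(ler_pM2l (exprn_gt0 m K0)).
  have pE (F : 'I_m -> R) : K ^+ m * \prod_i F i = \prod_i (K * F i).
    by rewrite big_split /= prodr_const card_ord.
  rewrite mulrCA pE mulrCA pE.
  apply: le_trans (_ : N' * \prod_i (K / u 0 i - 2) <= _).
    rewrite ler_wpM2l // ler_prod // => i _.
    rewrite mulrDr mulrCA mulfV ?gt_eqF // mulr1 lexx andbT.
    by rewrite subr_ge0 Ku.
  apply: le_trans (_ : N * \prod_i (K / v 0 i + 1) <= _); last first.
    rewrite ler_wpM2l // ler_prod // => i _.
    rewrite mulrDr mulrCA mulfV ?gt_eqF // mulr1 lexx andbT.
    by rewrite addr_ge0 // divr_ge0 // ltW.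
  rewrite mulrC (le_trans (ler_wpM2r _ _) (le_trans low (le_trans high _))) //.
    apply: le_trans (ger_int_points _) => [|i].
      rewrite ler_prod // => i _; rewrite !mxE subr0 -addrA -opprD lexx andbT.
      by rewrite subr_ge0.
    by rewrite !mxE subr0; have := Ku i; lra.
  rewrite mulrC ler_wpM2l //; apply: le_trans (ler_int_points _) _ => [i|].
    by rewrite !mxE divr_ge0 // ?ltW.
  rewrite ler_prod // => i _; rewrite !mxE subr0 lexx andbT.
  by rewrite addr_ge0 // divr_ge0 // ltW.
have pu : 0 < \prod_i u 0 i by apply: prodr_gt0.
have pv : 0 < \prod_i v 0 i by apply: prodr_gt0.
move: key; rewrite !prodfV ler_pdivrMr // mulrAC ler_pdivlMr //.
by under eq_bigr do rewrite vE; under [X in _ <= _ * X]eq_bigr do rewrite uE.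
Unshelve. all: by end_near.
Qed.

(** The density is the supremum over boxes of the count divided by the
    volume of the box enlarged by d.  The upper bound then holds by
    definition, and the lower bound is the comparison of two boxes. *)
Lemma evenly_spread_exists (d : R) X : 0 < d -> X !=set0 ->
  locally_finite X -> periodic_within d X ->
  exists2 rho, 0 < rho & evenly_spread d rho X.
Proof.
move=> d0 [y Xy] fX pX.
pose E := [set r : R | exists a b, (forall i, a 0 i <= b 0 i) /\
   r = (cnt (X `&` box a b))%:R / \prod_i (b 0 i - a 0 i + d)].
have p0 a b : (forall i, a 0 i <= b 0 i) -> 0 < \prod_i (b 0 i - a 0 i + d).
  by move=> ab; apply: prodr_gt0 => i _; rewrite ltr_pwDr // subr_ge0.
have q0 a b : (forall i, d < b 0 i - a 0 i) -> 0 < \prod_i (b 0 i - a 0 i - d).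
  by move=> ab; apply: prodr_gt0 => i _; rewrite subr_gt0.
have ubE a b : (forall i, d < b 0 i - a 0 i) ->
    ubound E ((cnt (X `&` box a b))%:R / \prod_i (b 0 i - a 0 i - d)).
  move=> ab _ [c [e [ce ->]]]; rewrite ler_pdivrMr ?p0 // mulrAC.
  by rewrite ler_pdivlMr ?q0 //; exact: cnt_box_cross.
have hasE : has_ubound E.
  eexists; apply: (ubE 0 (const_mx (d + 1))) => i; rewrite !mxE; lra.
have E0 : exists2 r, E r & 0 < r.
  pose y' : 'rV[R]_m := y + const_mx 1.
  have yy i : y 0 i <= y' 0 i by rewrite !mxE; lra.
  exists ((cnt (X `&` box y y'))%:R / \prod_i (y' 0 i - y 0 i + d)).
    by exists y, y'.
  rewrite divr_gt0 ?p0 // ltr0n.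
  have : (cnt [set y] <= cnt (X `&` box y y'))%N.
    by apply: cnt_le => [|_ ->]; [exact: fX|split=> // i; rewrite !mxE lexx /= ltrDl].
  by rewrite {1}/cnt fset_set1 cardfs1.
have [r0 Er0 r00] := E0.
exists (sup E); first by apply: lt_le_trans r00 _; exact: ub_le_sup.
split=> // a b ab.
  by rewrite -ler_pdivrMr ?p0 //; apply: ub_le_sup => //; exists a, b.
have [/forallP ab'|/forallPn[i]] := boolP [forall i, d < b 0 i - a 0 i].
  rewrite -ler_pdivlMr ?q0 //; apply: ge_sup; first by exists r0.
  exact: ubE.
rewrite -leNgt => abi; rewrite (bigD1 i) //= (_ : b 0 i - a 0 i - d = 0).
  by rewrite mul0r mulr0.
by have := ab i; lra.
Qed.

Definition scaled (k : R) X : set 'rV[R]_m := [set y | X (k *: y)].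

Lemma evenly_spread_scaled (k d rho : R) X : 0 < k ->
  evenly_spread d rho X -> evenly_spread (d / k) (k ^+ m * rho) (scaled k X).
Proof.
move=> k0 [fX uX lX].
have kn0 : k != 0 by rewrite gt_eqF.
have bE a b : [set k *: y | y in scaled k X `&` box a b] = X `&` box (k *: a) (k *: b).
  apply/seteqP; split=> [_ [y [Xy yab] <-]|y [Xy yab]].
    by split=> // i; have := yab i; rewrite !mxE ler_pM2l // ltr_pM2l.
  exists (k^-1 *: y); last by rewrite scalerA mulfV // scale1r.
  split=> [|i]; first by rewrite /scaled /= scalerA mulfV // scale1r.
  by have := yab i; rewrite !mxE ler_pdivlMl // ltr_pdivrMl.
have inj : injective (fun y : 'rV[R]_m => k *: y) by exact: scalerI.
have fsX : locally_finite (scaled k X).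
  move=> a b; have [] // := @cnt_image_le _ _ (fun y : 'rV[R]_m => k *: y)
     (scaled k X `&` box a b) _ (fX (k *: a) (k *: b)).
    by move=> x y _ _ /inj.
  by move=> y Hy; rewrite -bE; exists y.
have cE a b : cnt (scaled k X `&` box a b) = cnt (X `&` box (k *: a) (k *: b)).
  by rewrite -bE cnt_image.
have pE (F : 'I_m -> R) : k ^+ m * rho * \prod_i F i = rho * \prod_i (k * F i).
  by rewrite big_split /= prodr_const card_ord mulrCA mulrA.
split=> // a b ab; rewrite cE pE.
  apply: le_trans (uX _ _ _) _ => [i|]; first by rewrite !mxE ler_pM2l.
  rewrite le_eqVlt; apply/orP; left; apply/eqP; congr (_ * _).
  apply: eq_bigr => i _; rewrite !mxE mulrDr mulrBr [k * (d / k)]mulrC mulfVK //.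
apply: le_trans (lX _ _ _) => [|i].
  rewrite le_eqVlt; apply/orP; left; apply/eqP; congr (_ * _).
  apply: eq_bigr => i _; rewrite !mxE !mulrBr [k * (d / k)]mulrC mulfVK //.
by rewrite !mxE -mulrBr -ler_pdivrMl // mulrC.
Qed.

End Density.

(** * Counting in unions of boxes *)

Section ContentByCounting.
Context {R : realType} {m : nat}.
Implicit Types (a b c e t w y : 'rV[R]_m) (X A : set 'rV[R]_m).

Definition outer_sums A : set R := [set v | exists (k : nat) (a b : 'I_k -> 'rV[R]_m),
    [/\ forall k i, a k 0 i <= b k 0 i,
        A `<=` \bigcup_k box (a k) (b k) &
        v = \sum_(k < k) box_vol (a k) (b k)]].

Definition inner_sums A : set R := [set v | exists (k : nat) (a b : 'I_k -> 'rV[R]_m),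
    [/\ forall k i, a k 0 i <= b k 0 i,
        trivIset setT (fun k => box (a k) (b k)),
        \bigcup_k box (a k) (b k) `<=` A &
        v = \sum_(k < k) box_vol (a k) (b k)]].

Lemma cnt_box_near a b (eta : R) : (forall i, a 0 i <= b 0 i) -> 0 < eta ->
  \forall d \near 0^'+, forall X (rho : R), 0 <= rho -> evenly_spread d rho X ->
    rho * (box_vol a b - eta) <= (cnt (X `&` box a b))%:R <=
    rho * (box_vol a b + eta).
Proof.
move=> ab eta0.
have cvgD : \prod_i (b 0 i - a 0 i + d) @[d --> 0^'+] --> box_vol a b.
  apply: cvg_prodr => i; rewrite -[X in _ --> X]addr0.
  by apply: cvgD; [exact: cvg_cst|exact: cvg_at_right_filter cvg_id].
have cvgB : \prod_i (b 0 i - a 0 i - d) @[d --> 0^'+] --> box_vol a b.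
  apply: cvg_prodr => i; rewrite -[X in _ --> X]subr0.
  by apply: cvgB; [exact: cvg_cst|exact: cvg_at_right_filter cvg_id].
(* a flat box has volume 0, but its sides cannot be shrunk: the lower bound
   is trivial then *)
have [/forallP ab'|/forallPn[i abi]] := boolP [forall i, a 0 i < b 0 i].
  near=> d => X rho rho0 [_ uX lX]; apply/andP; split.
    apply: le_trans (lX _ _ _); last first.
      near: d; apply: filter_forall => i.
      by apply: nbhs_right_le; rewrite subr_gt0.
    rewrite ler_wpM2l //; apply: ltW; near: d.
    by move/cvgr_gt : cvgB; apply; rewrite gtrBl.
  apply: le_trans (uX _ _ ab) _; rewrite ler_wpM2l //; apply: ltW; near: d.
  by move/cvgr_lt : cvgD; apply; rewrite ltrDl.
near=> d => X rho rho0 [_ uX lX]; apply/andP; split.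
  have -> : box_vol a b = 0.
    rewrite /box_vol (bigD1 i) //= (_ : b 0 i - a 0 i = 0) ?mul0r //.
    by apply/eqP; rewrite subr_eq0 eq_le ab leNgt abi.
  by rewrite (@le_trans _ _ 0) // mulr_ge0_le0 // sub0r oppr_le0 ltW.
apply: le_trans (uX _ _ ab) _; rewrite ler_wpM2l //; apply: ltW; near: d.
by move/cvgr_lt : cvgD; apply; rewrite ltrDl.
Unshelve. all: by end_near.
Qed.

(** The upper bound for a union of boxes is uniform in X: it only depends on
    d, since finitely many boxes are involved. *)
Lemma cnt_outer_near A (v eta : R) : outer_sums A v -> 0 < eta ->
  \forall d \near 0^'+, forall X (rho : R), 0 <= rho -> evenly_spread d rho X ->
    (cnt (X `&` A))%:R <= rho * (v + eta).
Proof.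
move=> [k [a [b [ab Aab ->]]]] eta0.
have e0 : 0 < eta / k.+1%:R by rewrite divr_gt0.
near=> d => X rho rho0 sX.
have H : forall j : 'I_k, forall X (rho : R), 0 <= rho -> evenly_spread d rho X ->
    rho * (box_vol (a j) (b j) - eta / k.+1%:R) <= (cnt (X `&` box (a j) (b j)))%:R <=
    rho * (box_vol (a j) (b j) + eta / k.+1%:R).
  by near: d; apply: filter_forall => j; apply: cnt_box_near.
have [lX _ _] := sX.
have := @cnt_cover _ _ (index_enum 'I_k) (fun j => X `&` box (a j) (b j)) (X `&` A)
  (fun j _ => lX _ _).
move=> cov; apply: le_trans (_ : (\sum_j cnt (X `&` box (a j) (b j)))%:R <= _).
  rewrite ler_nat; apply: cov => y [Xy /Aab[j _ yj]].
  by exists j; [exact: mem_index_enum|].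
rewrite natr_sum.
apply: le_trans (_ : _ <= \sum_j rho * (box_vol (a j) (b j) + eta / k.+1%:R)) _.
  by apply: ler_sum => j _; have /andP[] := H j X rho rho0 sX.
rewrite -mulr_sumr big_split /= ler_wpM2l // lerD2l sumr_const card_ord.
by rewrite -(mulr_natr (eta / _)) -mulrA ler_piMr ?ltW // ltr_pdivrMl ?mulr1 ?ltr_nat.
Unshelve. all: by end_near.
Qed.

Lemma cnt_inner_near A (v eta : R) : inner_sums A v -> 0 < eta ->
  \forall d \near 0^'+, forall X (rho : R), 0 <= rho -> evenly_spread d rho X ->
    finite_set (X `&` A) -> rho * (v - eta) <= (cnt (X `&` A))%:R.
Proof.
move=> [k [a [b [ab tab Aab ->]]]] eta0.
have e0 : 0 < eta / k.+1%:R by rewrite divr_gt0.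
near=> d => X rho rho0 sX fA.
have H : forall j : 'I_k, forall X (rho : R), 0 <= rho -> evenly_spread d rho X ->
    rho * (box_vol (a j) (b j) - eta / k.+1%:R) <= (cnt (X `&` box (a j) (b j)))%:R <=
    rho * (box_vol (a j) (b j) + eta / k.+1%:R).
  by near: d; apply: filter_forall => j; apply: cnt_box_near.
have pack := @cnt_packing _ _ (index_enum 'I_k) (fun j => X `&` box (a j) (b j))
  (X `&` A) fA (index_enum_uniq _).
apply: le_trans (_ : _ <= (\sum_j cnt (X `&` box (a j) (b j)))%:R) _; last first.
  rewrite ler_nat; apply: pack => [j _ y [Xy yj]|i j y _ _ [_ yi] [_ yj]].
    by split=> //; apply: Aab; exists j.
  by apply: tab => //; exists y.
rewrite natr_sum.
apply: le_trans (_ : \sum_j rho * (box_vol (a j) (b j) - eta / k.+1%:R) <= _).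
  rewrite -mulr_sumr big_split /= ler_wpM2l // lerD2l sumr_const card_ord.
  rewrite mulNrn lerN2.
  by rewrite -(mulr_natr (eta / _)) -mulrA ler_piMr ?ltW // ltr_pdivrMl ?mulr1 ?ltr_nat.
by apply: ler_sum => j _; have /andP[] := H j X rho rho0 sX.
Unshelve. all: by end_near.
Qed.

End ContentByCounting.

(** * Lattices in coordinates *)

Section LatticePoints.
Context {R : realType} {m : nat}.
Implicit Types (a b c e t w x y : 'rV[R]_m) (X A : set 'rV[R]_m) (B M : 'M[R]_m).

Definition lattice_coset x B : set 'rV[R]_m :=
  [set y | exists z : 'rV[int]_m, y = x + map_mx intr z *m B].

Definition slab B (al be : R) : set 'rV[R]_m :=
  [set y | forall i, al <= (y *m invmx B) 0 i < be].

Definition cell B : set 'rV[R]_m := slab B 0 1.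

Lemma mulmx_coord_bound B : exists2 C : R, 0 <= C &
  forall y (s : R), (forall j, `|y 0 j| <= s) -> forall i, `|(y *m B) 0 i| <= C * s.
Proof.
exists (\sum_i \sum_j `|B j i|) => [|y s ys i].
  by apply: sumr_ge0 => i _; apply: sumr_ge0.
rewrite mxE; apply: le_trans (ler_norm_sum _ _ _) _.
apply: le_trans (_ : (\sum_j `|B j i|) * s <= _).
  rewrite mulr_suml; apply: ler_sum => j _.
  by rewrite normrM mulrC ler_wpM2l.
have [s0|s0] := leP 0 s; last first.
  by have := le_lt_trans (ys i) s0; rewrite ltNge normr_ge0.
rewrite ler_wpM2r // [leRHS](bigD1 i) //= lerDl.
by apply: sumr_ge0 => ? _; apply: sumr_ge0.
Qed.

Lemma intmx_inj : injective (fun z : 'rV[int]_m => map_mx intr z : 'rV[R]_m).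
Proof.
move=> z1 z2 /rowP z12; apply/rowP => i; have := z12 i; rewrite !mxE.
exact: intr_inj.
Qed.

Lemma lattice_coset_inj x B : B \in unitmx ->
  injective (fun z : 'rV[int]_m => x + map_mx intr z *m B).
Proof.
move=> uB z1 z2 /addrI /(congr1 (mulmxr (invmx B))) /=.
by rewrite !mulmxK // => /intmx_inj.
Qed.

Lemma box_coord_bound a b y i : box a b y ->
  `|y 0 i| <= \sum_j (`|a 0 j| + `|b 0 j|).
Proof.
move=> yab; rewrite (bigD1 i) //= (@le_trans _ _ (`|a 0 i| + `|b 0 i|)) //.
  have /andP[ay yb] := yab i.
  rewrite ler_norml; apply/andP; split.
    by have := lerNnormlW (lexx `|a 0 i|); have := normr_ge0 (b 0 i); lra.
  by have := ler_norm (b 0 i); have := normr_ge0 (a 0 i); lra.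
by rewrite lerDl; apply: sumr_ge0 => j _; rewrite addr_ge0.
Qed.

Lemma lattice_coset_finite x B : B \in unitmx ->
  locally_finite (lattice_coset x B).
Proof.
move=> uB a b; have [C C0 HC] := mulmx_coord_bound (invmx B).
pose s := \sum_j (`|a 0 j| + `|b 0 j|) + \sum_j `|x 0 j|.
pose D := C * s.
have f1 := @finite_int_points R m (const_mx (- D)) (const_mx (D + 1)).
apply: (@sub_finite_set _ _ [set x + map_mx intr z *m B | z in
  int_points (const_mx (- D) : 'rV[R]_m) (const_mx (D + 1))]); last exact: finite_image.
move=> _ [[z ->] zab]; exists z => // i; rewrite !mxE.
have : `|((x + map_mx intr z *m B - x) *m invmx B) 0 i| <= D.
  apply: HC => j; move: (x + _) zab => u uab.
  rewrite !mxE (le_trans (ler_normB _ _)) // lerD //; first exact: box_coord_bound.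
  rewrite (bigD1 j) //= lerDl.
  by apply: sumr_ge0 => ? _.
by rewrite addrC addKr mulmxK // mxE ler_norml; lra.
Qed.

Definition covering_within (d : R) B := forall t, exists z : 'rV[int]_m,
  forall i, t 0 i <= (map_mx intr z *m B) 0 i <= t 0 i + d.

Lemma covering_periodic (d : R) x B : covering_within d B ->
  periodic_within d (lattice_coset x B).
Proof.
move=> cB t; have [z zt] := cB t; exists (map_mx intr z *m B); split=> // y [z' ->].
exists (z' + z); rewrite -addrA -mulmxDl; congr (_ + _ *m _).
by apply/rowP => i; rewrite !mxE intrD.
Qed.

Lemma covering_within_exists B : B \in unitmx ->
  exists2 d : R, 0 < d & covering_within d B.
Proof.
move=> uB; have [C C0 HC] := mulmx_coord_bound B.
exists (2 * C + 1) => [|t]; first by lra.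
pose u := (t + const_mx C) *m invmx B.
exists (\row_i Num.floor (u 0 i)) => i; set z := map_mx _ _.
have : `|((z - u) *m B) 0 i| <= C * 1.
  apply: HC => j; rewrite !mxE ler_norml.
  have := floor_le (u 0 j); have := floorD1_gt (u 0 j); rewrite mxE intrD.
  lra.
rewrite mulmxBl mulmxKV // !mxE ler_norml; lra.
Qed.

Lemma lattice_coset_spread x B (d : R) : B \in unitmx -> 0 < d ->
  covering_within d B ->
  exists2 rho : R, 0 < rho & evenly_spread d rho (lattice_coset x B).
Proof.
move=> uB d0 cB; apply: evenly_spread_exists => //.
- by exists x; exists 0; rewrite map_mx0 mul0mx addr0.
- exact: lattice_coset_finite.
- exact: covering_periodic.
Qed.

(** In the coordinates given by B the points of the coset are integer points
    up to a translation, and the slab is a cube. *)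
Lemma cnt_slab x B (k al be : R) : B \in unitmx -> 0 < k ->
  let N := cnt (scaled k (lattice_coset x B) `&` slab B al be) in
  (al <= be -> N%:R <= (k * (be - al) + 1) ^+ m) /\
  (1 <= k * (be - al) -> (k * (be - al) - 1) ^+ m <= N%:R).
Proof.
move=> uB k0 N.
pose x' := x *m invmx B.
pose a : 'rV[R]_m := \row_i (k * al - x' 0 i).
pose b : 'rV[R]_m := \row_i (k * be - x' 0 i).
have NE : N = cnt (int_points a b).
  pose g (z : 'rV[int]_m) := k^-1 *: (x + map_mx intr z *m B).
  rewrite /N (_ : _ `&` _ = g @` int_points a b).
    rewrite cnt_image //; last exact: finite_int_points.
    move=> z1 z2 g12; apply: (lattice_coset_inj uB (x := x)).
    by apply: scalerI g12; rewrite invr_eq0 gt_eqF.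
  have gz z i : (g z *m invmx B) 0 i = k^-1 * (x' 0 i + (z 0 i)%:~R).
    by rewrite -scalemxAl mulmxDl mulmxK // !mxE.
  have eqv z i : al <= (g z *m invmx B) 0 i < be = (a 0 i <= (z 0 i)%:~R < b 0 i).
    by rewrite gz ler_pdivlMl // ltr_pdivrMl // !mxE lerBlDl ltrBrDl.
  apply/seteqP; split=> [y [[z yz] yab]|_ [z zab <-]].
    have yg : y = g z by rewrite /g -yz scalerA mulVf ?scale1r // gt_eqF.
    by exists z => // i; rewrite -eqv -yg.
  split=> [|i]; last by rewrite eqv.
  by exists z; rewrite scalerA mulfV ?scale1r // gt_eqF.
have ba i : b 0 i - a 0 i = k * (be - al) by rewrite !mxE; ring.
split=> H.
  rewrite NE (le_trans (ler_int_points _)) => [//|i|].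
    by rewrite -subr_ge0 ba mulr_ge0 ?subr_ge0 // ltW.
  by under eq_bigr do rewrite ba; rewrite prodr_const card_ord.
rewrite NE (le_trans _ (ger_int_points _)) => [//||i]; last by rewrite ba.
by under eq_bigr do rewrite ba; rewrite prodr_const card_ord.
Qed.

End LatticePoints.

(** * Inner and outer content *)

Section JordanCounting.
Context {R : realType} {m : nat}.
Implicit Types (a b c e t w x y : 'rV[R]_m) (X A : set 'rV[R]_m) (B M : 'M[R]_m).

Lemma near_harmonic (P : R -> Prop) (d : R) : 0 < d ->
  (\forall e \near 0^'+, P e) -> \forall n \near \oo, P (d / n.+1%:R).
Proof.
move=> d0 [e /= e0 He]; near=> n.
have dn0 : 0 < d / n.+1%:R by rewrite divr_gt0.
apply: He => //=; rewrite sub0r normrN gtr0_norm //.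
near: n; have : d / n.+1%:R @[n --> \oo] --> (0 : R).
  by have := @cvg_add_harmonic R 0 d; under eq_fun do rewrite add0r.
by move/cvgr_lt; exact.
Unshelve. all: by end_near.
Qed.

Lemma outer_sums_finite X A (v : R) : locally_finite X -> outer_sums A v ->
  finite_set (X `&` A).
Proof.
move=> fX [k [a [b [_ Aab _]]]].
apply: (@sub_finite_set _ _ (\bigcup_j (X `&` box (a j) (b j)))).
  by move=> y [Xy /Aab[j _ yj]]; exists j.
by apply: bigcup_finite => // j _; exact: fX.
Qed.

(** Scaled copies of Z^m serve as the rulers by which sums of box volumes
    are compared. *)
Lemma fine_lattices : exists2 d : R, 0 < d & exists2 rho : R, 0 < rho &
  forall n, evenly_spread (d / n.+1%:R) (n.+1%:R ^+ m * rho)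
     (scaled n.+1%:R (lattice_coset (0 : 'rV[R]_m) 1%:M)).
Proof.
have [d d0 cd] := covering_within_exists (@unitmx1 R m).
have [rho rho0 s] := lattice_coset_spread 0 (unitmx1 R m) d0 cd.
by exists d => //; exists rho => // n; apply: evenly_spread_scaled.
Qed.

(** Both sums approximate, after division by the density, the number of
    points of a fine lattice in A.  This replaces the subdivision of boxes
    along common hyperplanes. *)
Lemma inner_sums_le_outer_sums A (v w : R) :
  inner_sums A v -> outer_sums A w -> v <= w.
Proof.
move=> Av Aw; apply/ler_addgt0Pr => eta eta0.
have e2 : 0 < eta / 2 by rewrite divr_gt0.
have [d d0 [rho rho0 sp]] := fine_lattices.
have [n [Hi Ho]] := filter_ex (filterI (near_harmonic d0 (cnt_inner_near Av e2))
  (near_harmonic d0 (cnt_outer_near Aw e2))).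
have rn0 : 0 < n.+1%:R ^+ m * rho by rewrite mulr_gt0 // exprn_gt0.
have [fX _ _] := sp n.
have := le_trans (Hi _ _ (ltW rn0) (sp n) (outer_sums_finite fX Aw))
                 (Ho _ _ (ltW rn0) (sp n)).
by rewrite ler_pM2l //; lra.
Qed.

Lemma inner_sums0 A : inner_sums A 0.
Proof.
exists 0%N, (fun=> 0), (fun=> 0); split=> //; last by rewrite big_ord0.
  by move=> [].
by move=> y [[]].
Qed.

Lemma outer_sums_box a b : (forall i, a 0 i <= b 0 i) ->
  outer_sums (box a b) (box_vol a b).
Proof.
move=> ab; exists 1%N, (fun=> a), (fun=> b); split=> //; last by rewrite big_ord1.
by move=> y yab; exists ord0.
Qed.

Lemma inner_sums_box a b : (forall i, a 0 i <= b 0 i) ->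
  inner_sums (box a b) (box_vol a b).
Proof.
move=> ab; exists 1%N, (fun=> a), (fun=> b); split=> //; last by rewrite big_ord1.
  by move=> i j _ _ _; rewrite !ord1.
by move=> y [].
Qed.

Lemma outer_sums_sub A A' (v : R) : A `<=` A' -> outer_sums A' v -> outer_sums A v.
Proof.
move=> AA' [k [a [b [ab A'ab ->]]]]; exists k, a, b; split=> //.
exact: subset_trans AA' A'ab.
Qed.

Lemma inner_sums_sub A A' (v : R) : A `<=` A' -> inner_sums A v -> inner_sums A' v.
Proof.
move=> AA' [k [a [b [ab tab Aab ->]]]]; exists k, a, b; split=> //.
exact: subset_trans Aab AA'.
Qed.

Lemma bounded_outer_sums A : (exists a b, A `<=` box a b) -> outer_sums A !=set0.
Proof.
move=> [a [b Aab]].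
have [[y Ay]|/nonemptyPn ->] := pselect (A !=set0).
  exists (box_vol a b); apply: (outer_sums_sub Aab); apply: outer_sums_box => i.
  by have /andP[ay yb] := Aab y Ay i; rewrite (le_trans ay) // ltW.
exists 0; exists 0%N, (fun=> 0), (fun=> 0); split=> //; last by rewrite big_ord0.
Qed.

Lemma outer_content_le A (v : R) : outer_sums A v -> outer_content A <= v.
Proof.
move=> Av; apply: ge_inf => //; exists 0 => w Aw.
exact: inner_sums_le_outer_sums (inner_sums0 A) Aw.
Qed.

Lemma le_inner_content A (v : R) : (exists a b, A `<=` box a b) ->
  inner_sums A v -> v <= inner_content A.
Proof.
move=> /bounded_outer_sums[w Aw] Av; apply: ub_le_sup => //; exists w => v' Av'.
exact: inner_sums_le_outer_sums Av' Aw.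
Qed.

Lemma inner_sums_le_outer_content A (v : R) : (exists a b, A `<=` box a b) ->
  inner_sums A v -> v <= outer_content A.
Proof.
move=> bA Av; apply: lb_le_inf; first exact: bounded_outer_sums.
by move=> w Aw; exact: inner_sums_le_outer_sums Av Aw.
Qed.

Lemma inner_le_outer A : (exists a b, A `<=` box a b) ->
  inner_content A <= outer_content A.
Proof.
move=> bA; apply: ge_sup; first by exists 0; exact: inner_sums0.
by move=> v Av; exact: inner_sums_le_outer_content.
Qed.

Lemma outer_content_box a b : (forall i, a 0 i <= b 0 i) ->
  outer_content (box a b) = box_vol a b.
Proof.
move=> ab; apply/eqP; rewrite eq_le outer_content_le /=; last exact: outer_sums_box.
by apply: inner_sums_le_outer_content (inner_sums_box ab); exists a, b.
Qed.

(** The quantifier over X comes after the choice of d, so the estimate applies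
    to a family of lattices that changes with d. *)
Lemma jordan_cnt_near A (eta : R) : jordan_measurable A -> 0 < eta ->
  \forall d \near 0^'+, forall X (rho : R), 0 <= rho -> evenly_spread d rho X ->
    rho * (outer_content A - eta) <= (cnt (X `&` A))%:R <=
    rho * (outer_content A + eta).
Proof.
move=> [bA jA] eta0.
have e2 : 0 < eta / 2 by rewrite divr_gt0.
have hi : has_inf (outer_sums A).
  split; first exact: bounded_outer_sums.
  by exists 0 => w Aw; exact: inner_sums_le_outer_sums (inner_sums0 A) Aw.
have hs : has_sup (inner_sums A).
  split; first by exists 0; exact: inner_sums0.
  by exists (outer_content A) => w Aw; exact: inner_sums_le_outer_content.
have [w Aw wA] := inf_adherent e2 hi; have [v Av vA] := sup_adherent e2 hs.
rewrite -/(outer_content A) in wA; rewrite -/(inner_content A) jA in vA.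
near=> d => X rho rho0 sX; apply/andP; split.
  apply: (@le_trans _ _ (rho * (v - eta / 2))).
    by rewrite ler_wpM2l //; move: vA; set o := outer_content A; lra.
  have fA : finite_set (X `&` A) by have [fX _ _] := sX; exact: outer_sums_finite fX Aw.
  move: X rho rho0 sX fA; near: d; exact: cnt_inner_near.
apply: (@le_trans _ _ (rho * (w + eta / 2))); last first.
  by rewrite ler_wpM2l //; move: wA; set o := outer_content A; lra.
move: X rho rho0 sX; near: d; exact: cnt_outer_near.
Unshelve. all: by end_near.
Qed.

Lemma grid_cell_vol (s : R) (z : 'rV[int]_m) :
  box_vol (\row_i ((z 0 i)%:~R * (const_mx s : 'rV[R]_m) 0 i))
          (\row_i (((z 0 i)%:~R + 1) * (const_mx s : 'rV[R]_m) 0 i)) = s ^+ m.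
Proof.
rewrite /box_vol (eq_bigr (fun=> s)) ?prodr_const ?card_ord // => i _.
by rewrite !mxE; ring.
Qed.

Lemma grid_outer_sums A (s : R) (J : {fset 'rV[int]_m}) : 0 < s ->
  (forall y, A y -> exists2 z, z \in J & grid_cell (const_mx s) z y) ->
  outer_sums A (#|` J|%:R * s ^+ m).
Proof.
move=> s0 AJ; pose z (i : 'I_#|` J|) := nth 0 J i.
exists #|` J|, (fun k => \row_i ((z k 0 i)%:~R * (const_mx s : 'rV[R]_m) 0 i)),
  (fun k => \row_i (((z k 0 i)%:~R + 1) * (const_mx s : 'rV[R]_m) 0 i)); split.
- by move=> k i; rewrite !mxE ler_wpM2r ?lerDl ?ltW.
- move=> y /AJ[z0 z0J z0y].
  have iJ : (index z0 J < #|` J|)%N by rewrite index_mem.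
  by exists (Ordinal iJ) => //; rewrite /z /= nth_index.
- under eq_bigr do rewrite grid_cell_vol.
  by rewrite sumr_const card_ord mulr_natl.
Qed.

Lemma grid_inner_sums A (s : R) (J : {fset 'rV[int]_m}) : 0 < s ->
  (forall z, z \in J -> grid_cell (const_mx s) z `<=` A) ->
  inner_sums A (#|` J|%:R * s ^+ m).
Proof.
move=> s0 JA; pose z (i : 'I_#|` J|) := nth 0 J i.
exists #|` J|, (fun k => \row_i ((z k 0 i)%:~R * (const_mx s : 'rV[R]_m) 0 i)),
  (fun k => \row_i (((z k 0 i)%:~R + 1) * (const_mx s : 'rV[R]_m) 0 i)); split.
- by move=> k i; rewrite !mxE ler_wpM2r ?lerDl ?ltW.
- move=> k1 k2 _ _ [y []].
  rewrite -!/(grid_cell _ _) => y1 y2.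
  have s0' i : 0 < (const_mx s : 'rV[R]_m) 0 i by rewrite mxE.
  have /grid_cellP -/(_ s0') z1 := y1; have /grid_cellP -/(_ s0') z2 := y2.
  apply/val_inj/eqP; rewrite -(nth_uniq 0 (ltn_ord k1) (ltn_ord k2) (fset_uniq J)).
  by apply/eqP; rewrite -/(z k1) -/(z k2) z1 z2.
- move=> y [k _ yk]; apply: (JA (z k)) => //; exact: mem_nth.
- under eq_bigr do rewrite grid_cell_vol.
  by rewrite sumr_const card_ord mulr_natl.
Qed.

End JordanCounting.

(** * The content of a fundamental cell *)

Section CellContent.
Context {R : realType} {m : nat}.
Implicit Types (a b c e t w x y : 'rV[R]_m) (X A : set 'rV[R]_m) (B M : 'M[R]_m).

Lemma slab_bounded B (al be : R) : B \in unitmx ->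
  exists a b, slab B al be `<=` box a b.
Proof.
move=> uB; have [C C0 HC] := mulmx_coord_bound B.
pose D := C * (`|al| + `|be|).
exists (const_mx (- D)), (const_mx (D + 1)) => y yab i; rewrite !mxE.
have : `|(y *m invmx B *m B) 0 i| <= D.
  apply: HC => j; have /andP[ay yb] := yab j.
  have := ler_norm be; have := ler_norm (- al); rewrite normrN => a1 b1.
  have := normr_ge0 al; have := normr_ge0 be => b0 a0.
  by rewrite ler_norml; apply/andP; split; lra.
by rewrite mulmxKV // ler_norml; lra.
Qed.

Lemma cell_bounded B : B \in unitmx -> exists a b, cell B `<=` box a b.
Proof. exact: slab_bounded. Qed.

Lemma cvg_pow_harmonic (c C : R) :
  c * (1 + C / n.+1%:R) ^+ m @[n --> \oo] --> c.
Proof.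
have H : \prod_(i < m) (1 + C / n.+1%:R : R) @[n --> \oo] --> \prod_(i < m) (1 : R).
  by apply: cvg_prodr => i; exact: cvg_add_harmonic.
have -> : (fun n => c * (1 + C / n.+1%:R) ^+ m) =
    (fun n => c * \prod_(i < m) (1 + C / n.+1%:R)).
  by apply/funext => n; rewrite prodr_const card_ord.
by rewrite -[X in _ --> X]mulr1; apply: cvgMr; rewrite big1 in H.
Qed.

(** The grid cubes of side s that meet the cell cover it and lie in a slab
    slightly larger than the cell.  Each of them holds about k^m rho s^m
    points of the lattice refined by k, and the slab about k^m points.  With
    s = 1 / l and k = l ^ 2 the refined lattice is fine at the scale of the
    grid, and all the errors are of order 1 / l. *)
Lemma outer_cell_le x B (d rho : R) : B \in unitmx -> 0 < d -> 0 < rho ->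
  evenly_spread d rho (lattice_coset x B) ->
  outer_content (cell B) * rho <= 1.
Proof.
move=> uB d0 rho0 sp.
have [C C0 HC] := mulmx_coord_bound (invmx B).
have [a [b cab]] := cell_bounded uB.
pose f n : R := outer_content (cell B) * rho * (1 + (- d) / n.+1%:R) ^+ m.
pose g n : R := 1 * (1 + (2 * C + 1) / n.+1%:R) ^+ m.
apply: (@ler_cvg_to _ \oo _ R f g); [exact: cvg_pow_harmonic|exact: cvg_pow_harmonic|].
near=> n; rewrite /f /g mul1r.
pose l : R := n.+1%:R.
have l0 : 0 < l by rewrite ltr0n.
have l1 : 1 <= l by rewrite ler1n.
have dl : d <= l.
  rewrite (le_trans _ (_ : n%:R <= _)) ?ler_nat //.
  by near: n; exact: nbhs_infty_ger.
pose s := l^-1; have [k kE] : exists k, k = l ^+ 2 by exists (l ^+ 2).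
have s0 : 0 < s by rewrite invr_gt0.
have k0 : 0 < k by rewrite kE exprn_gt0.
have ks : k * s = l by rewrite kE /s expr2 mulfK // gt_eqF.
have spk := evenly_spread_scaled k0 sp.
have [fY _ lY] := spk; set Y := scaled k _ in fY lY.
pose ws : 'rV[R]_m := const_mx s.
have ws0 i : 0 < ws 0 i by rewrite mxE.
pose J0 := [set z | exists2 y, cell B y & grid_cell ws z y].
have fJ0 : finite_set J0.
  have := finite_int_points (l *: a - const_mx 1) (l *: b).
  apply: sub_finite_set => z [y /cab yab zy] i.
  have := yab i; have := zy i; rewrite !mxE /s ler_pdivrMr // ltr_pdivlMr //.
  move=> /andP[h1 h2] /andP[h3 h4].
  have h5 := ler_wpM2l (ltW l0) h3.
  have h6 : l * y 0 i < l * b 0 i by rewrite ltr_pM2l.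
  by rewrite [l * y _ _]mulrC in h5 h6; apply/andP; split; lra.
pose J := fset_set J0.
have JP z : z \in J -> exists2 y, cell B y & grid_cell ws z y.
  by rewrite /J in_fset_set // inE.
have ub : outer_content (cell B) <= #|` J|%:R * s ^+ m.
  apply: outer_content_le; apply: grid_outer_sums => // y cy.
  exists (\row_i Num.floor (y 0 i / ws 0 i)); last exact/grid_cellP.
  by rewrite in_fset_set // inE; exists y => //; exact/grid_cellP.
pose al := - (C * s); pose be := 1 + C * s.
have Cs0 : 0 <= C * s by rewrite mulr_ge0 // ltW.
have : #|` J|%:R * (k ^+ m * rho * (s - d / k) ^+ m) <= (cnt (Y `&` slab B al be))%:R.
  apply: (@grid_packing _ _ _ _ ws) => //.
  - have [a' [b' ab']] := slab_bounded al be uB.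
    by apply: sub_finite_set (fY a' b') => y [Yy /ab'].
  - move=> z /JP[y' cy' zy'] y [_ zy] i.
    have yy' : `|((y - y') *m invmx B) 0 i| <= C * s.
      apply: HC => j; rewrite !mxE ler_norml.
      have := zy j; have := zy' j; rewrite !mxE; lra.
    move: yy'; rewrite mulmxBl mxE [X in _ + X]mxE ler_norml.
    by have := cy' i; rewrite /al /be; lra.
  - move=> z _; have := lY (\row_i ((z 0 i)%:~R * ws 0 i))
      (\row_i (((z 0 i)%:~R + 1) * ws 0 i)).
    rewrite (eq_bigr (fun=> s - d / k)) => [|i _]; last by rewrite !mxE; ring.
    rewrite prodr_const card_ord; apply => i; rewrite !mxE.
    rewrite -mulrBl addrAC subrr add0r mul1r ler_pdivrMr // mulrC ks.
    exact: dl.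
have [sl _] := @cnt_slab R m x B k al be uB k0.
move=> /le_trans/(_ (sl _)); rewrite /al /be => le1.
have {le1 sl} := le1 ltac:(lra).
have -> : s - d / k = s * (1 + - d / l).
  by rewrite /s kE; field; rewrite gt_eqF.
have -> : k * (1 + C * s - - (C * s)) + 1 = k * (1 + (2 * C + s) / l).
  by rewrite /s kE; field; rewrite gt_eqF.
rewrite !exprMn => le1.
have q0 : 0 <= 1 + - d / l.
  by rewrite mulNr subr_ge0 ler_pdivrMr // mul1r.
rewrite -(ler_pM2l (exprn_gt0 m k0)).
apply: le_trans (_ : k ^+ m * (1 + (2 * C + s) / l) ^+ m <= _); last first.
  rewrite ler_wpM2l ?exprn_ge0 ?(ltW k0) //; apply: lerXn2r; rewrite ?nnegrE.
  - by rewrite addr_ge0 // divr_ge0 ?(ltW l0) // addr_ge0 ?(ltW s0) // mulr_ge0.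
  - by rewrite addr_ge0 // divr_ge0 ?(ltW l0) // addr_ge0 // mulr_ge0.
  - by rewrite lerD2l ler_wpM2r ?invr_ge0 ?(ltW l0) // lerD2l invf_le1.
apply: le_trans le1; rewrite -/l.
have -> : #|` J|%:R * (k ^+ m * rho * (s ^+ m * (1 + - d / l) ^+ m)) =
  k ^+ m * (#|` J|%:R * s ^+ m * (rho * (1 + - d / l) ^+ m)) by ring.
rewrite ler_wpM2l ?exprn_ge0 ?(ltW k0) // -mulrA ler_wpM2r //.
by rewrite mulr_ge0 ?exprn_ge0 // ltW.
Unshelve. all: by end_near.
Qed.

(** Dual to the outer estimate: the grid cubes contained in the cell cover a
    slab slightly smaller than the cell. *)
Lemma inner_cell_ge x B (d rho : R) : B \in unitmx -> 0 < d -> 0 < rho ->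
  evenly_spread d rho (lattice_coset x B) ->
  1 <= inner_content (cell B) * rho.
Proof.
move=> uB d0 rho0 sp.
have [C C0 HC] := mulmx_coord_bound (invmx B).
have bc := cell_bounded uB; have [a [b cab]] := bc.
pose f n : R := 1 * (1 + (- (2 * C + 1)) / n.+1%:R) ^+ m.
pose g n : R := inner_content (cell B) * rho * (1 + d / n.+1%:R) ^+ m.
apply: (@ler_cvg_to _ \oo _ R f g); [exact: cvg_pow_harmonic|exact: cvg_pow_harmonic|].
near=> n; rewrite /f /g mul1r.
pose l : R := n.+1%:R.
have l0 : 0 < l by rewrite ltr0n.
have l1 : 1 <= l by rewrite ler1n.
(* for smaller l the shrunken slab may be empty *)
have Cl : 2 * C + 1 <= l.
  rewrite (le_trans _ (_ : n%:R <= _)) ?ler_nat //.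
  by near: n; exact: nbhs_infty_ger.
pose s := l^-1; have [k kE] : exists k, k = l ^+ 2 by exists (l ^+ 2).
have s0 : 0 < s by rewrite invr_gt0.
have k0 : 0 < k by rewrite kE exprn_gt0.
have ks : k * s = l by rewrite kE /s expr2 mulfK // gt_eqF.
have [fY uY _] := evenly_spread_scaled k0 sp; set Y := scaled k _ in fY uY.
pose ws : 'rV[R]_m := const_mx s.
have ws0 i : 0 < ws 0 i by rewrite mxE.
pose J0 := [set z | grid_cell ws z `<=` cell B].
have fJ0 : finite_set J0.
  have := finite_int_points (l *: a - const_mx 1) (l *: b).
  apply: sub_finite_set => z zc i.
  pose y : 'rV[R]_m := \row_i ((z 0 i)%:~R * ws 0 i).
  have : cell B y by apply: zc => j; rewrite !mxE lexx /= ltr_pM2r // ltrDl ltr01.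
  move=> /cab/(_ i); rewrite !mxE /s ler_pdivlMr // ltr_pdivrMr //.
  by move=> /andP[h1 h2]; rewrite [l * _]mulrC [l * _]mulrC; apply/andP; split; lra.
pose J := fset_set J0.
have JP z : z \in J -> grid_cell ws z `<=` cell B.
  by rewrite /J in_fset_set // inE.
have lb : #|` J|%:R * s ^+ m <= inner_content (cell B).
  by apply: le_inner_content => //; apply: grid_inner_sums.
pose al := C * s; pose be := 1 - C * s.
have Cs0 : 0 <= C * s by rewrite mulr_ge0 // ltW.
have : (cnt (Y `&` slab B al be))%:R <= #|` J|%:R * (k ^+ m * rho * (s + d / k) ^+ m).
  apply: (@grid_covering _ _ _ _ ws) => //.
  - move=> y' _ Ty'; have yz' : grid_cell ws (\row_i Num.floor (y' 0 i / ws 0 i)) y'.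
      exact/grid_cellP.
    exists (\row_i Num.floor (y' 0 i / ws 0 i)) => //.
    rewrite in_fset_set // inE => y yz i.
    have yy' : `|((y - y') *m invmx B) 0 i| <= C * s.
      apply: HC => j; rewrite !mxE ler_norml.
      have := yz j; have := yz' j; rewrite !mxE; lra.
    move: yy'; rewrite mulmxBl mxE [X in _ + X]mxE ler_norml.
    by have := Ty' i; rewrite /al /be; lra.
  - move=> z _; have := uY (\row_i ((z 0 i)%:~R * ws 0 i))
      (\row_i (((z 0 i)%:~R + 1) * ws 0 i)).
    rewrite (eq_bigr (fun=> s + d / k)) => [|i _]; last by rewrite !mxE; ring.
    rewrite prodr_const card_ord; apply => i; rewrite !mxE.
    by rewrite ler_wpM2r ?lerDl ?(ltW s0).
have [_ sl] := @cnt_slab R m x B k al be uB k0.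
have hk : k * (be - al) - 1 = k * (1 + - (2 * C + s) / l).
  by rewrite /al /be /s kE; field; rewrite gt_eqF.
have hk1 : 1 <= k * (be - al).
  rewrite /be /al (_ : k * _ = k - 2 * C * (k * s)); last by ring.
  rewrite ks kE expr2; nra.
move: sl => /(_ hk1); rewrite hk => /le_trans/[apply].
have -> : s + d / k = s * (1 + d / l).
  by rewrite /s kE; field; rewrite gt_eqF.
rewrite !exprMn => le1.
have s1 : s <= 1 by rewrite invf_le1.
rewrite -(ler_pM2l (exprn_gt0 m k0)).
apply: (@le_trans _ _ (k ^+ m * (1 + - (2 * C + s) / l) ^+ m)).
  rewrite ler_wpM2l ?exprn_ge0 ?(ltW k0) //; apply: lerXn2r; rewrite ?nnegrE.
  - by rewrite mulNr subr_ge0 ler_pdivrMr // mul1r.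
  - by rewrite mulNr subr_ge0 ler_pdivrMr // mul1r; lra.
  - by rewrite lerD2l ler_wpM2r ?invr_ge0 ?(ltW l0) // lerN2 lerD2l.
apply: le_trans le1 _; rewrite -/l.
have -> : #|` J|%:R * (k ^+ m * rho * (s ^+ m * (1 + d / l) ^+ m)) =
  k ^+ m * (#|` J|%:R * s ^+ m * (rho * (1 + d / l) ^+ m)) by ring.
rewrite ler_wpM2l ?exprn_ge0 ?(ltW k0) // -[leRHS]mulrA ler_wpM2r //.
by rewrite mulr_ge0 ?exprn_ge0 ?ltW // addr_gt0 // divr_gt0.
Unshelve. all: by end_near.
Qed.

(** The density of a lattice is the inverse of the content of a cell, whatever
    the pair (d, rho) that witnesses the even spread; in particular rho does
    not depend on d nor on the coset. *)
Lemma cell_content x B (d rho : R) : B \in unitmx -> 0 < d -> 0 < rho ->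
  evenly_spread d rho (lattice_coset x B) ->
  rho = (outer_content (cell B))^-1 /\ jordan_measurable (cell B).
Proof.
move=> uB d0 rho0 sp.
have bc := cell_bounded uB.
have o1 := outer_cell_le uB d0 rho0 sp; have i1 := inner_cell_ge uB d0 rho0 sp.
have io := inner_le_outer bc.
have io' : inner_content (cell B) * rho <= outer_content (cell B) * rho.
  by rewrite ler_pM2r.
have oE : outer_content (cell B) * rho = 1.
  by apply/eqP; rewrite eq_le o1 (le_trans i1).
have iE : inner_content (cell B) * rho = 1.
  by apply/eqP; rewrite eq_le i1 (le_trans io').
have rn0 : rho != 0 by rewrite gt_eqF.
split; last by split=> //; apply: (mulIf rn0); rewrite iE oE.
have o0 : outer_content (cell B) != 0.
  by apply: contra_eq_neq oE => ->; rewrite mul0r eq_sym oner_neq0.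
by apply: (mulfI o0); rewrite oE mulfV.
Qed.

End CellContent.

(** * Volumes of cells and counts of lattice points *)

Section CellVolume.
Context {R : realType} {m : nat}.
Implicit Types (a b c e t w x y : 'rV[R]_m) (X A : set 'rV[R]_m) (B M : 'M[R]_m).

Definition cellvol B : R := outer_content (cell B).

Lemma cell_jordan B : B \in unitmx -> 0 < cellvol B /\ jordan_measurable (cell B).
Proof.
move=> uB; have [d d0 cd] := covering_within_exists uB.
have [rho rho0 sp] := lattice_coset_spread 0 uB d0 cd.
have [rhoE jB] := cell_content uB d0 rho0 sp.
by split=> //; rewrite -invr_gt0 -rhoE.
Qed.

Lemma lattice_coset_density x B (d : R) : B \in unitmx -> 0 < d ->
  covering_within d B -> evenly_spread d (cellvol B)^-1 (lattice_coset x B).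
Proof.
move=> uB d0 cd; have [rho rho0 sp] := lattice_coset_spread x uB d0 cd.
by have [<- _] := cell_content uB d0 rho0 sp.
Qed.

Lemma cnt_scaled_cvg B A : B \in unitmx -> jordan_measurable A ->
  (cnt (scaled n.+1%:R (lattice_coset 0 B) `&` A))%:R / n.+1%:R ^+ m
    @[n --> \oo] --> outer_content A / cellvol B.
Proof.
move=> uB jA; have [d d0 cd] := covering_within_exists uB.
have sp := lattice_coset_density 0 uB d0 cd.
have [v0 _] := cell_jordan uB.
apply/cvgrPdist_le => eta eta0.
have eta' : 0 < eta * cellvol B by rewrite mulr_gt0.
apply: filterS (near_harmonic d0 (jordan_cnt_near jA eta')) => n H.
have n0 : 0 < n.+1%:R :> R by rewrite ltr0n.
have k0 := exprn_gt0 m n0.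
have v0' : 0 <= (cellvol B)^-1 by rewrite invr_ge0 ltW.
have /andP[lo hi] := H _ _ (mulr_ge0 (ltW k0) v0') (evenly_spread_scaled n0 sp).
set k := _ ^+ m in k0 lo hi *; set N := _%:R in lo hi *.
rewrite distrC ler_distl ler_pdivlMr // ler_pdivrMr //.
have -> : (outer_content A / cellvol B - eta) * k =
  k * (cellvol B)^-1 * (outer_content A - eta * cellvol B) by field; rewrite gt_eqF.
have -> : (outer_content A / cellvol B + eta) * k =
  k * (cellvol B)^-1 * (outer_content A + eta * cellvol B) by field; rewrite gt_eqF.
by rewrite lo hi.
Qed.

Lemma diag_mx_unit (d : 'rV[R]_m) : (forall i, 0 < d 0 i) -> diag_mx d \in unitmx.
Proof.
by move=> d0; rewrite unitmxE det_diag unitfE; apply/prodf_neq0 => i _; rewrite gt_eqF.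
Qed.

Lemma mulmx_inv_diag (d y : 'rV[R]_m) i : (forall i, 0 < d 0 i) ->
  (y *m invmx (diag_mx d)) 0 i = y 0 i / d 0 i.
Proof.
move=> d0; have ud := diag_mx_unit d0.
suff -> : y *m invmx (diag_mx d) = \row_i (y 0 i / d 0 i) by rewrite mxE.
apply: (can_inj (mulmxK ud)); rewrite mulmxKV //; apply/rowP => j.
by rewrite mul_mx_diag !mxE mulfVK // gt_eqF.
Qed.

Lemma cell_diag (d : 'rV[R]_m) : (forall i, 0 < d 0 i) ->
  cell (diag_mx d) = box 0 d.
Proof.
move=> d0; apply/seteqP; split=> y yd i; have := yd i; rewrite mulmx_inv_diag // !mxE.
  by rewrite ler_pdivlMr // ltr_pdivrMr // mul0r mul1r.
by rewrite ler_pdivlMr // ltr_pdivrMr // mul0r mul1r.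
Qed.

Lemma cellvol_diag (d : 'rV[R]_m) : (forall i, 0 < d 0 i) ->
  cellvol (diag_mx d) = \prod_i d 0 i.
Proof.
move=> d0; rewrite /cellvol cell_diag // outer_content_box => [|i]; last first.
  by rewrite mxE ltW.
by apply: eq_bigr => i _; rewrite mxE subr0.
Qed.

Lemma cellvol1 : cellvol 1%:M = 1.
Proof.
rewrite -diag_const_mx cellvol_diag => [|i]; last by rewrite mxE.
by rewrite big1 // => i _; rewrite mxE.
Qed.

(** The refinements of the lattice of B in the cell of the inverse of M
    correspond under M to the refinements of the lattice of B *m M in the unit
    cube; both counts have a known limit. *)
Lemma cellvol_mulV B M : B \in unitmx -> M \in unitmx ->
  cellvol (invmx M) / cellvol B = (cellvol (B *m M))^-1.
Proof.
move=> uB uM.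
have uBM : B *m M \in unitmx by rewrite unitmx_mul uB.
have uV : invmx M \in unitmx by rewrite unitmx_inv.
have [_ jV] := cell_jordan uV; have [_ j1] := cell_jordan (unitmx1 R m).
have c1 := cnt_scaled_cvg uB jV.
have c2 := cnt_scaled_cvg uBM j1.
rewrite -[RHS]mul1r -cellvol1; apply: cvg_unique c1 _ => //=.
suff E n : cnt (scaled n.+1%:R (lattice_coset 0 B) `&` cell (invmx M)) =
    cnt (scaled n.+1%:R (lattice_coset 0 (B *m M)) `&` cell 1%:M).
  by under eq_fun do rewrite E.
have fV : finite_set (scaled n.+1%:R (lattice_coset 0 B) `&` cell (invmx M)).
  have [d d0 cd] := covering_within_exists uB.
  have [fX _ _] := evenly_spread_scaled (ltr0Sn R n) (lattice_coset_density 0 uB d0 cd).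
  have [a [b ab]] := cell_bounded uV.
  by apply: sub_finite_set (fX a b) => y [Xy /ab].
have -> : scaled n.+1%:R (lattice_coset 0 (B *m M)) `&` cell 1%:M =
    (mulmxr M) @` (scaled n.+1%:R (lattice_coset 0 B) `&` cell (invmx M)).
  apply/seteqP; split=> [y [[z yz] y1]|_ [y [[z yz] y1] <-]] /=.
    exists (y *m invmx M) => /=; last by rewrite mulmxKV.
    split; last first.
      by move=> i; rewrite invmxK mulmxKV //; have := y1 i; rewrite invmx1 mulmx1.
    exists z; rewrite add0r; rewrite add0r in yz.
    by rewrite scalemxAl yz mulmxA mulmxK.
  split; last by move=> i; rewrite invmx1 mulmx1; have := y1 i; rewrite invmxK.
  exists z; rewrite add0r; rewrite add0r in yz.
  by rewrite /= scalemxAl yz mulmxA.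
rewrite cnt_image // => y1 y2 /(congr1 (mulmxr (invmx M))) /=.
by rewrite !mulmxK.
Qed.

Lemma cellvol_mul B M : B \in unitmx -> M \in unitmx ->
  cellvol (B *m M) = cellvol B * cellvol M.
Proof.
move=> uB uM; apply: invr_inj; rewrite -cellvol_mulV // invfM mulrC; congr (_ * _).
by have := cellvol_mulV (unitmx1 R m) uM; rewrite mul1mx cellvol1 divr1.
Qed.

(** Equidistribution: the only hypothesis on the lattice is its covering
    radius, and the estimate is uniform in the lattice and in the coset. *)
Lemma lattice_coset_cnt_near A (eta : R) : jordan_measurable A -> 0 < eta ->
  \forall d \near 0^'+, forall x B, B \in unitmx -> covering_within d B ->
    `|(cnt (lattice_coset x B `&` A))%:R * cellvol B - outer_content A| <= eta.
Proof.
move=> jA eta0; near=> d => x B uB cd.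
have d0 : 0 < d by near: d; exact: nbhs_right_gt.
have [v0 _] := cell_jordan uB.
have : forall X (rho : R), 0 <= rho -> evenly_spread d rho X ->
    rho * (outer_content A - eta) <= (cnt (X `&` A))%:R <=
    rho * (outer_content A + eta) by near: d; exact: jordan_cnt_near.
have v0' : 0 <= (cellvol B)^-1 by rewrite invr_ge0 ltW.
move=> /(_ _ _ v0' (lattice_coset_density x uB d0 cd)) /andP[].
by rewrite ler_pdivrMl // ler_pdivlMl // mulrC ler_distl => -> ->.
Unshelve. all: by end_near.
Qed.

End CellVolume.

(** * Transference *)

Section Transference.
Context {R : realType}.

Definition sqn {m} (v : 'rV[R]_m) : R := (v *m v^T) 0 0.

Lemma sqnE m (v : 'rV[R]_m) : sqn v = \sum_i v 0 i ^+ 2.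
Proof. by rewrite /sqn mxE; apply: eq_bigr => i _; rewrite mxE expr2. Qed.

Lemma sqn_ge0 m (v : 'rV[R]_m) : 0 <= sqn v.
Proof. by rewrite sqnE sumr_ge0 // => i _; rewrite sqr_ge0. Qed.

Lemma sqnZ m (c : R) (v : 'rV[R]_m) : sqn (c *: v) = c ^+ 2 * sqn v.
Proof.
by rewrite !sqnE mulr_sumr; apply: eq_bigr => i _; rewrite mxE exprMn.
Qed.

Lemma sqnD_orth m (u v : 'rV[R]_m) : u *m v^T = 0 -> sqn (u + v) = sqn u + sqn v.
Proof.
move=> uv; have vu : v *m u^T = 0 by rewrite -[LHS]trmxK trmx_mul trmxK uv trmx0.
by rewrite /sqn linearD /= mulmxDl !mulmxDr uv vu addr0 add0r mxE.
Qed.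

(** The infimum of the squared lengths need not be known to be attained: a
    vector within the factor 4 / 3 of it is enough.  The Smith normal form of
    its coefficient row a shows that a is a multiple of a row of a unimodular
    matrix, and this row gives a vector that is no longer than the chosen one. *)
Lemma unimodular_near_shortest k m (Y : 'M[R]_(1 + k, m)) (nu : R) : 0 < nu ->
  (forall a : 'rV[int]_(1 + k), a != 0 -> nu <= sqn (map_mx intr a *m Y)) ->
  exists2 U : 'M[int]_(1 + k), U \in unitmx &
    forall b : 'rV[int]_(1 + k), b != 0 ->
      3 / 4 * sqn (row 0 (map_mx intr U *m Y)) <= sqn (map_mx intr b *m Y).
Proof.
move=> nu0 Ynu.
pose E := [set r : R | exists2 a : 'rV[int]_(1 + k), a != 0 &
  r = sqn (map_mx intr a *m Y)].
have e0 : (delta_mx 0 0 : 'rV[int]_(1 + k)) != 0.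
  by apply/eqP => /matrixP/(_ 0 0); rewrite !mxE !eqxx.
have E0 : E !=set0.
  exists (sqn (map_mx intr (delta_mx 0 0 : 'rV[int]_(1 + k)) *m Y)).
  by exists (delta_mx 0 0).
have lE : lbound E nu by move=> _ [a a0 ->]; exact: Ynu.
have i0 : 0 < inf E by apply: lt_le_trans nu0 (lb_le_inf E0 lE).
have [|_ [a a0 ->] ai] := @inf_adherent _ E (inf E / 3) _ (conj E0 (ex_intro _ _ lE)).
  by rewrite divr_gt0.
have [L uL [U uU [d _ aE]]] := int_Smith_normal_form a.
exists U => // b b0.
have bi : inf E <= sqn (map_mx intr b *m Y).
  by apply: ge_inf; [exists nu|exists b].
pose c := L 0 0 * d`_0.
have aU : a = c *: row 0 U.
  rewrite {1}aE; apply/rowP => j; rewrite !mxE big_ord_recl big1 => [|i _].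
    by rewrite !mxE big_ord1 !mxE mulr1n addr0.
  by rewrite !mxE big_ord1 !mxE mulr0n mulr0 mul0r.
have c0 : c != 0 by apply: contra_neq a0 => c0; rewrite aU c0 scale0r.
have c1 : 1 <= (c%:~R : R) ^+ 2.
  rewrite -rmorphXn /= ler1z -gtz0_ge1.
  by rewrite exprn_even_gt0 //= c0.
have : sqn (map_mx intr a *m Y) = c%:~R ^+ 2 * sqn (row 0 (map_mx intr U *m Y)).
  by rewrite {1}aU map_mxZ map_row -scalemxAl -row_mul sqnZ.
move=> aE'; rewrite aE' in ai.
have := sqn_ge0 (row 0 (map_mx intr U *m Y)).
move: ai bi; set s := sqn (row _ _); set i := inf E => ai bi s0.
have : s <= c%:~R ^+ 2 * s by rewrite ler_peMl.
lra.
Qed.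

(** A point g near x with prescribed residues modulo 1 of its products with
    the rows of Y.  Induction on the number of rows: move an almost shortest
    integer combination v of the rows to the first place, round the product
    with v, which displaces x by at most 1 / (2 |v|), and continue with the
    other rows projected orthogonally to v.  By size reduction a nonzero
    combination of the projected rows has squared length at least
    (3 / 4 - 1 / 4) |v|^2, so that nu is at most halved.  The residues theta
    are needed for the induction, because the rounding along v shifts the
    residues of the other rows; so is the fact that g - x lies in the row
    space of Y, which keeps the successive displacements orthogonal. *)
Lemma inhomogeneous_approx k m (Y : 'M[R]_(k, m)) (nu : R) : 0 < nu ->
  (forall a : 'rV[int]_k, a != 0 -> nu <= sqn (map_mx intr a *m Y)) ->
  forall (theta : 'rV[R]_k) (x : 'rV[R]_m), exists (g : 'rV[R]_m) (z : 'rV[int]_k),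
  [/\ g *m Y^T = theta + map_mx intr z,
      exists delta : 'rV[R]_k, g - x = delta *m Y &
      sqn (g - x) <= (2 ^+ k - 1) / nu].
Proof.
elim: k m Y nu => [|k IH] m Y nu nu0 Ynu theta x.
  exists x, 0; split; first by apply/rowP => -[].
    by exists 0; rewrite subrr mul0mx.
  by rewrite subrr subrr mul0r /sqn mul0mx mxE.
have [U uU near] := unimodular_near_shortest nu0 Ynu.
pose UR := map_mx intr U : 'M[R]_(1 + k).
have uUR : UR \in unitmx by rewrite unitmxE det_map_mx rmorph_unit // -unitmxE.
pose Y' := UR *m (Y : 'M[R]_(1 + k, m)).
have Y'nu (b : 'rV[int]_(1 + k)) : b != 0 ->
    nu <= sqn (map_mx intr b *m Y') /\
    3 / 4 * sqn (row 0 Y') <= sqn (map_mx intr b *m Y').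
  move=> b0; have bU0 : b *m U != 0.
    by apply: contra_neq b0 => bU; rewrite -(mulmxK uU b) bU mul0mx.
  by rewrite /Y' mulmxA -map_mxM; split; [exact: Ynu|exact: near].
have [v vE] : exists v, v = usubmx Y' by exists (usubmx Y').
have [W WE] : exists W, W = dsubmx Y' by exists (dsubmx Y').
have Y'E : Y' = col_mx v W by rewrite vE WE vsubmxK.
have rv : row 0 Y' = v.
  by rewrite Y'E; apply/rowP => j; rewrite !mxE; case: splitP => // i _; rewrite ord1.
pose N := sqn v.
have N0 : nu <= N.
  have r0 : row_mx 1%:M 0 != 0 :> 'rV[int]_(1 + k).
    by apply/eqP => /(congr1 lsubmx)/matrixP/(_ 0 0); rewrite row_mxKl !mxE.
  have [H _] := Y'nu _ r0; move: H.
  by rewrite map_row_mx map_mx1 map_mx0 Y'E mul_row_col mul1mx mul0mx addr0.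
have N00 : 0 < N by exact: lt_le_trans N0.
have vv : v *m v^T = N%:M by apply/matrixP => i j; rewrite !ord1 [RHS]mxE.
pose c : 'cV[R]_k := N^-1 *: (W *m v^T).
pose Y2 := W - c *m v.
have Y2v : Y2 *m v^T = 0.
  rewrite mulmxBl -mulmxA vv mul_mx_scalar scalerA mulfV ?gt_eqF // scale1r.
  by rewrite subrr.
have Y2nu (b : 'rV[int]_k) : b != 0 -> nu / 2 <= sqn (map_mx intr b *m Y2).
  move=> b0; pose tau := (map_mx intr b *m c) 0 0.
  (* size reduction: subtract the nearest integer multiple of v *)
  pose n := Num.floor (tau + 2^-1).
  have rb0 : row_mx (- n%:M) b != 0 :> 'rV_(1 + k).
    by apply: contra_neq b0 => /(congr1 rsubmx); rewrite row_mxKr linear0.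
  have [_] := Y'nu _ rb0.
  have -> : map_mx intr (row_mx (- n%:M) b) *m Y' =
      map_mx intr b *m Y2 + (tau - n%:~R) *: v.
    rewrite Y'E map_row_mx mul_row_col /Y2 mulmxBr.
    have -> : map_mx intr (- n%:M) = - (n%:~R)%:M :> 'M[R]_1.
      by apply/matrixP => i j; rewrite !ord1 !mxE !eqxx !mulr1n rmorphN.
    rewrite mulNmx mul_scalar_mx mulmxA.
    have -> : map_mx intr b *m c = tau%:M.
      by apply/matrixP => i j; rewrite !ord1 [RHS]mxE.
    by rewrite mul_scalar_mx scalerBl addrA subrK addrC.
  rewrite sqnD_orth; last by rewrite linearZ /= -scalemxAr -mulmxA Y2v mulmx0 scaler0.
  rewrite sqnZ rv -/N.
  have : (tau - n%:~R) ^+ 2 <= 4^-1.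
    have := floor_le (tau + 2^-1); have := floorD1_gt (tau + 2^-1).
    rewrite -/n intrD => h1 h2.
    have : `|tau - n%:~R| <= 2^-1 by rewrite ler_norml; apply/andP; split; lra.
    rewrite -[_ ^+ 2]real_normK ?num_real // => h3.
    by have := ler_pM (normr_ge0 _) (normr_ge0 _) h3 h3; rewrite expr2; lra.
  move=> h; have := ler_wpM2r (ltW N00) h; lra.
have nu20 : 0 < nu / 2 by rewrite divr_gt0.
have [theta' thetaE] : exists t, t = (theta : 'rV[R]_(1 + k)) *m UR^T by eexists.
pose xv := (x *m v^T) 0 0.
pose t0 := theta' 0 0.
(* p is the element of t0 + Z nearest to the product of x and v *)
pose j := Num.floor (xv - t0 + 2^-1).
pose p := t0 + j%:~R.
have pxv : (p - xv) ^+ 2 <= 4^-1.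
  have := floor_le (xv - t0 + 2^-1); have := floorD1_gt (xv - t0 + 2^-1).
  rewrite -/j intrD => h1 h2.
  have : `|p - xv| <= 2^-1 by rewrite /p ler_norml; apply/andP; split; lra.
  rewrite -[_ ^+ 2]real_normK ?num_real // => h3.
  by have := ler_pM (normr_ge0 _) (normr_ge0 _) h3 h3; rewrite expr2; lra.
(* the residues of the other rows are corrected by the part p *: c^T already
   contributed by the component along v *)
have [g2 [z2 [g2Y [delta g2x] g2le]]] := IH m Y2 (nu / 2) nu20 Y2nu
  (rsubmx theta' - p *: c^T) (x - (xv / N) *: v).
have xvE : x *m v^T = xv%:M by apply/matrixP => i i'; rewrite !ord1 [RHS]mxE.
have g2v : g2 *m v^T = 0.
  have -> : g2 = delta *m Y2 + (x - (xv / N) *: v) by rewrite -g2x subrK.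
  rewrite mulmxDl -mulmxA Y2v mulmx0 add0r mulmxBl -scalemxAl vv xvE.
  by rewrite scale_scalar_mx divfK ?gt_eqF // subrr.
pose g := g2 + (p / N) *: v.
have gv : g *m v^T = p%:M.
  by rewrite mulmxDl g2v add0r -scalemxAl vv scale_scalar_mx divfK // gt_eqF.
have gW : g *m W^T = rsubmx theta' + map_mx intr z2.
  have -> : W = Y2 + c *m v by rewrite subrK.
  rewrite linearD /= mulmxDr trmx_mul mulmxA gv mul_scalar_mx mulmxDl g2Y.
  have -> : (p / N) *: v *m Y2^T = 0.
    by rewrite -scalemxAl -[v *m _]trmxK trmx_mul trmxK Y2v trmx0 scaler0.
  by rewrite addr0 addrAC subrK.
have gx : g - x = (g2 - (x - (xv / N) *: v)) + ((p - xv) / N) *: v.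
  by apply/rowP => i; rewrite !mxE; ring.
have gY' : g *m Y'^T = theta' + map_mx intr (row_mx j%:M z2).
  rewrite Y'E tr_col_mx mul_mx_row gv gW map_row_mx -[theta' in RHS]hsubmxK.
  rewrite add_row_mx; congr row_mx.
  apply/matrixP => i i'; rewrite !ord1 !mxE !eqxx !mulr1n /p /t0.
  by congr (theta' _ _ + _); apply/val_inj.
exists g, (row_mx j%:M z2 *m (invmx U)^T); split.
- have -> : g *m Y^T = (g *m Y'^T) *m (invmx UR)^T.
    by rewrite /Y' trmx_mul mulmxA -mulmxA -trmx_mul mulVmx // trmx1 mulmx1.
  have iU : map_mx intr (invmx U) = invmx UR.
    apply: (can_inj (mulmxK uUR)); rewrite -map_mxM mulVmx // mulVmx //.
    by rewrite map_mx1.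
  rewrite gY' mulmxDl map_mxM -map_trmx iU; congr (_ + _).
  by rewrite thetaE -mulmxA -trmx_mul mulVmx // trmx1 mulmx1.
- exists (row_mx (((p - xv) / N)%:M - delta *m c) delta *m UR).
  rewrite -mulmxA -/Y' Y'E mul_row_col gx g2x mulmxBl mul_scalar_mx /Y2 mulmxBr.
  by rewrite mulmxA addrC addrA addrAC.
- rewrite gx sqnD_orth; last first.
    by rewrite g2x linearZ /= -scalemxAr -mulmxA Y2v mulmx0 scaler0.
  rewrite sqnZ -/N.
  have -> : ((p - xv) / N) ^+ 2 * N = (p - xv) ^+ 2 / N by field; rewrite gt_eqF.
  have h1 : (p - xv) ^+ 2 / N <= 4^-1 / nu.
    apply: ler_pM => //; first exact: sqr_ge0.
      by rewrite invr_ge0 ltW.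
    by rewrite lef_pV2 // posrE.
  apply: le_trans (lerD g2le h1) _.
  rewrite invf_div mulrA -mulrDl ler_wpM2r ?invr_ge0 ?(ltW nu0) // exprS.
  lra.
Qed.

(** Rows of the transpose of the inverse of B form the basis dual to the rows
    of B: a point whose products with them are integers is a lattice point. *)
Lemma covering_of_dual_min m (B : 'M[R]_m) (nu d : R) : B \in unitmx -> 0 < nu ->
  0 < d -> 2 ^+ m / nu <= (d / 2) ^+ 2 ->
  (forall a : 'rV[int]_m, a != 0 -> nu <= sqn (map_mx intr a *m (invmx B)^T)) ->
  covering_within d B.
Proof.
move=> uB nu0 d0 nud anu t.
have [g [z [gz _ gx]]] := inhomogeneous_approx nu0 anu 0 (t + const_mx (d / 2)).
exists z => i.
have gB : g = map_mx intr z *m B by rewrite -[_ z](add0r) -gz trmxK mulmxKV.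
have : (g 0 i - (t 0 i + d / 2)) ^+ 2 <= (d / 2) ^+ 2.
  apply: le_trans nud; apply: le_trans (_ : (2 ^+ m - 1) / nu <= _).
    apply: le_trans gx; rewrite sqnE (bigD1 i) //= !mxE lerDl.
    by apply: sumr_ge0 => j _; exact: sqr_ge0.
  by rewrite ler_wpM2r ?invr_ge0 ?(ltW nu0) // gerBl.
rewrite -gB => h.
have : `|g 0 i - (t 0 i + d / 2)| <= d / 2.
  by rewrite -ler_sqr ?nnegrE ?divr_ge0 ?(ltW d0) // real_normK ?num_real.
by rewrite ler_norml => /andP[h1 h2]; apply/andP; split; lra.
Qed.

End Transference.

(** * Contracted lattices *)

Section Contraction.
Context {R : realType} {m : nat}.
Implicit Types (B P Q : 'M[R]_m).

Lemma sqn_mulmx_le Q : exists2 K : R, 0 < K &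
  forall v : 'rV[R]_m, sqn (v *m Q) <= K * sqn v.
Proof.
have [C C0 HC] := mulmx_coord_bound Q.
exists (m%:R * C ^+ 2 + 1) => [|v].
  by rewrite ltr_wpDl // mulr_ge0 ?sqr_ge0.
have s0 := sqn_ge0 v.
have vs j : `|v 0 j| <= Num.sqrt (sqn v).
  rewrite -sqrtr_sqr ler_wsqrtr // sqnE (bigD1 j) //= lerDl.
  by apply: sumr_ge0 => i _; exact: sqr_ge0.
rewrite mulrDl mul1r ler_wpDr // [sqn (_ *m _)]sqnE.
apply: le_trans (_ : \sum_(i < m) C ^+ 2 * sqn v <= _).
  apply: ler_sum => i _; have := HC v _ vs i.
  rewrite -[in X in _ -> _ <= X](sqr_sqrtr s0) -exprMn.
  rewrite -[_ ^+ 2 in X in _ -> X]real_normK ?num_real //.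
  by move=> h; apply: lerXn2r => //; rewrite nnegrE ?mulr_ge0 ?sqrtr_ge0.
by rewrite sumr_const card_ord -mulrA mulr_natl.
Qed.

Lemma sqn_mulmx_ge Q : Q \in unitmx -> exists2 c : R, 0 < c &
  forall v : 'rV[R]_m, c * sqn v <= sqn (v *m Q).
Proof.
move=> uQ; have [K K0 HK] := sqn_mulmx_le (invmx Q).
exists K^-1 => [|v]; first by rewrite invr_gt0.
by rewrite ler_pdivrMl // -{1}(mulmxK uQ v).
Qed.

Definition contraction (h : pred 'I_m) (eps : R) : 'rV[R]_m :=
  \row_i (if h i then eps else 1).

Lemma contraction_gt0 h (eps : R) i : 0 < eps -> 0 < contraction h eps 0 i.
Proof. by move=> e0; rewrite mxE; case: ifP. Qed.

(** P is the matrix of a basis in which the contraction is diagonal, with h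
    the contracted directions.  The dual vector of coefficients a has
    coordinates a *m (P *m invmx B)^T in the dual of this basis, and the
    contraction divides those indexed by h by eps.  Dual vectors outside a
    finite set are long from the start, and each of the others has a nonzero
    coordinate in h. *)
Lemma covering_contraction B P (h : pred 'I_m) (d : R) :
  B \in unitmx -> P \in unitmx -> 0 < d ->
  (forall a : 'rV[int]_m, a != 0 ->
    exists2 i, h i & (map_mx intr a *m (P *m invmx B)^T) 0 i != 0) ->
  \forall eps \near 0^'+,
    covering_within d (B *m invmx P *m diag_mx (contraction h eps) *m P).
Proof.
move=> uB uP d0 indep.
pose Q := (P *m invmx B)^T; rewrite -/Q in indep.
have uQ : Q \in unitmx by rewrite unitmx_tr unitmx_mul uP unitmx_inv.
have uPT : (invmx P)^T \in unitmx by rewrite unitmx_tr unitmx_inv.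
have [c c0 Hc] := sqn_mulmx_ge uPT.
have [c' c'0 Hc'] := sqn_mulmx_ge uQ.
(* the length of dual vectors that makes the lattice d-covering *)
pose nu0 : R := 2 ^+ m / (d / 2) ^+ 2.
have nu00 : 0 < nu0 by rewrite divr_gt0 ?exprn_gt0 ?divr_gt0.
pose nu := nu0 / c.
have nu0' : 0 < nu by rewrite divr_gt0.
pose K := Num.sqrt (nu / c').
pose J := fset_set (int_points (const_mx (- K) : 'rV[R]_m) (const_mx (K + 1))).
have nearJ : \forall eps \near 0^'+, forall a : J, \val a != 0 ->
    nu <= sqn (map_mx intr (\val a) *m Q *m invmx (diag_mx (contraction h eps))).
  apply: filter_forall => a.
  have [a0|a0] := eqVneq (\val a) 0; first by near=> eps.
  have [i hi wi0] := indep _ a0; set w := _ *m Q in wi0 *.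
  near=> eps => _.
  have e0 : 0 < eps by near: eps; exact: nbhs_right_gt.
  have ei : eps <= `|w 0 i| / Num.sqrt nu.
    by near: eps; apply: nbhs_right_le; rewrite divr_gt0 ?normr_gt0 ?sqrtr_gt0.
  rewrite sqnE (bigD1 i) //= ler_wpDr ?sumr_ge0 // => [j _|]; first exact: sqr_ge0.
  rewrite mulmx_inv_diag => [|j]; last exact: contraction_gt0.
  rewrite [contraction _ _ _ _]mxE hi -{1}(sqr_sqrtr (ltW nu0')).
  rewrite -[leRHS]real_normK ?num_real //.
  apply: lerXn2r; rewrite ?nnegrE ?sqrtr_ge0 // normrM normfV (gtr0_norm e0).
  by move: ei; rewrite !ler_pdivlMr ?sqrtr_gt0 // mulrC.
near=> eps.
have e0 : 0 < eps by near: eps; exact: nbhs_right_gt.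
have e1 : eps <= 1 by near: eps; exact: nbhs_right_le.
have HJ : forall a : J, \val a != 0 ->
    nu <= sqn (map_mx intr (\val a) *m Q *m invmx (diag_mx (contraction h eps))).
  by near: eps; exact: nearJ.
have dg0 i : 0 < contraction h eps 0 i by exact: contraction_gt0.
have uD := diag_mx_unit dg0; set D := diag_mx _ in HJ uD *.
have uN : B *m invmx P *m D *m P \in unitmx.
  by rewrite !unitmx_mul uB unitmx_inv uP uD.
apply: (@covering_of_dual_min _ _ _ nu0) => //.
  by rewrite /nu0 invf_div mulrCA mulfV ?mulr1 // expf_neq0.
move=> a a0.
have -> : map_mx intr a *m (invmx (B *m invmx P *m D *m P))^T =
    map_mx intr a *m Q *m invmx D *m (invmx P)^T.
  have -> : invmx (B *m invmx P *m D *m P) = invmx P *m (invmx D *m (P *m invmx B)).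
    apply: (can_inj (mulmxK uN)); rewrite mulVmx // -!mulmxA.
    by rewrite mulKmx // mulKVmx // mulKmx // mulVmx.
  by rewrite trmx_mul [(invmx D *m _)^T]trmx_mul (trmx_inv D) tr_diag_mx !mulmxA.
apply: le_trans (Hc _); rewrite -ler_pdivrMl // mulrC -/nu.
have [aJ|aNJ] := boolP (a \in J); first exact: (HJ [` aJ]%fset).
have aK : exists i, K <= `|a 0 i|%:~R.
  apply/not_existsP => aK; case/negP: aNJ.
  rewrite in_fset_set ?inE; last exact: finite_int_points.
  move=> i; have /negP := aK i; rewrite -ltNge intr_norm ltr_norml !mxE.
  by move=> /andP[/ltW -> h2] /=; lra.
have {aK}[i aK] := aK.
apply: (@le_trans _ _ (c' * sqn (map_mx intr a : 'rV[R]_m))).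
  rewrite -ler_pdivrMl // mulrC sqnE (bigD1 i) //= ler_wpDr ?sumr_ge0 // => [j _|].
    exact: sqr_ge0.
  have nc0 : 0 <= nu / c' by rewrite divr_ge0 ?ltW.
  rewrite mxE -(sqr_sqrtr nc0) -[leRHS]real_normK ?num_real //.
  by apply: lerXn2r; rewrite ?nnegrE ?sqrtr_ge0 // -intr_norm.
apply: le_trans (Hc' _) _; rewrite !sqnE; apply: ler_sum => j _.
rewrite mulmx_inv_diag // expr_div_n ler_peMr ?sqr_ge0 // invf_ge1 ?exprn_gt0 //.
by rewrite exprn_ile1 ?(ltW (dg0 j)) // mxE; case: ifP.
Unshelve. all: by end_near.
Qed.

End Contraction.

Section ContractedLattice.
Context {R : realType} {m : nat}.

Lemma contracted_lattice_cvg (B P : 'M[R]_m) (h : pred 'I_m) (x : R -> 'rV[R]_m)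
    (A : set 'rV[R]_m) : B \in unitmx -> P \in unitmx ->
  (forall a : 'rV[int]_m, a != 0 ->
    exists2 i, h i & (map_mx intr a *m (P *m invmx B)^T) 0 i != 0) ->
  jordan_measurable A ->
  eps ^+ #|h| * (cnt (lattice_coset (x eps)
      (B *m (invmx P *m diag_mx (contraction h eps) *m P)) `&` A))%:R
    @[eps --> 0^'+] --> outer_content A / cellvol B.
Proof.
move=> uB uP indep jA; apply/cvgrPdist_le => eta eta0.
have [vB0 _] := cell_jordan uB.
have eta' : 0 < eta * cellvol B by rewrite mulr_gt0.
have [d d0 Hd] : exists2 d : R, 0 < d & forall (x : 'rV[R]_m) M, M \in unitmx ->
    covering_within d M ->
    `|(cnt (lattice_coset x M `&` A))%:R * cellvol M - outer_content A| <=
      eta * cellvol B.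
  have near_d := lattice_coset_cnt_near jA eta'.
  near (0 : R)^'+ => d; exists d; last by near: d.
  by near: d; exact: nbhs_right_gt.
have cov := covering_contraction uB uP d0 indep.
near=> eps.
have e0 : 0 < eps by near: eps; exact: nbhs_right_gt.
have uD : diag_mx (contraction h eps) \in unitmx.
  by apply: diag_mx_unit => i; exact: contraction_gt0.
have uV : invmx P \in unitmx by rewrite unitmx_inv.
set N := B *m _.
have uN : N \in unitmx by rewrite !unitmx_mul uB uV uD.
have vN : cellvol N = eps ^+ #|h| * cellvol B.
  rewrite /N !cellvol_mul ?unitmx_mul ?uV ?uD //.
  have : cellvol (invmx P) * cellvol P = 1 by rewrite -cellvol_mul // mulVmx // cellvol1.
  rewrite cellvol_diag => [|i]; last exact: contraction_gt0.
  have -> : \prod_i contraction h eps 0 i = eps ^+ #|h|.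
    under eq_bigr do rewrite mxE.
    by rewrite -big_mkcond /= prodr_const.
  move=> VP; rewrite mulrAC VP mul1r mulrC //.
have := Hd (x eps) N uN _.
have cN : covering_within d N by rewrite /N !mulmxA; near: eps.
move=> /(_ cN); rewrite vN => H.
rewrite distrC -(ler_pM2r vB0); apply: le_trans H.
rewrite -[X in _ * X](gtr0_norm vB0) -normrM mulrBl mulfVK ?gt_eqF //.
by rewrite mulrCA mulrA.
Unshelve. all: by end_near.
Qed.
End ContractedLattice.

(** * Orthogonality and dual bases *)

Section Duality.
Context {R : realType} {E : vectType R} (dot : {dot E for idfun}).
Implicit Types (U : {vspace E}) (x y : E).

Lemma dotC x y : dot x y = dot y x.
Proof. by rewrite hermC /= expr0 mul1r. Qed.

Lemma dot_eq0 x : dot x x = 0 -> x = 0.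
Proof.
move=> x0; apply/eqP/negPn/negP => xn0.
by have := @neq0_dnorm_gt0 _ _ _ dot _ xn0; rewrite x0 ltxx.
Qed.

Lemma dot_ge0 x : 0 <= dot x x.
Proof.
have [->|x0] := eqVneq x 0; first by rewrite linear0l.
exact: ltW (@neq0_dnorm_gt0 _ _ _ dot _ x0).
Qed.

Lemma orthP U x : reflect (forall y, y \in U -> dot x y = 0) (x \in orthov dot U).
Proof. exact: mem_orthovP. Qed.

(** Gram-Schmidt on a spanning list of U. *)
Lemma orth_decomp U x : exists2 u, u \in U & x - u \in orthov dot U.
Proof.
rewrite -(span_basis (vbasisP U)); elim: (val (vbasis U)) x => [|v X IH] x.
  exists 0; first by rewrite mem0v.
  by apply/mem_orthovP => y; rewrite span_nil memv0 => /eqP ->; rewrite linear0r.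
have [v' v'X vv'] := IH v; have [x' x'X xx'] := IH x.
set w := v - v' in vv'; set z := x - x' in xx'.
pose c := dot z w / dot w w.
have Xs : (<<X>> <= <<v :: X>>)%VS by rewrite span_cons addvSr.
have vX : v \in <<v :: X>>%VS by rewrite memv_span // mem_head.
exists (x' + c *: w).
  by rewrite memvD ?memvZ ?memvB //; apply: (subvP Xs).
apply/mem_orthovP => y; rewrite span_cons => /memv_addP[_ /vlineP[a ->] [y' y'X ->]].
have wX u : u \in <<X>>%VS -> dot w u = 0 by move/mem_orthovP: vv'; exact.
have zX u : u \in <<X>>%VS -> dot z u = 0 by move/mem_orthovP: xx'; exact.
have -> : a *: v + y' = a *: w + (a *: v' + y') by rewrite /w scalerBr addrA subrK.
have aX : a *: v' + y' \in <<X>>%VS by rewrite memvD // memvZ.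
rewrite opprD addrA -/z; clear xx' vv' IH; clearbody z w.
rewrite linearDr /= linearBl /= linearBl /= (zX _ aX).
have -> : dot (c *: w) (a *: v' + y') = 0 by rewrite linearZl_LR /= wX // mulr0.
rewrite subr0 addr0 !linearZr_LR /= linearZl_LR /= -mulrBr.
have [w0|w0] := eqVneq w 0; first by rewrite w0 !linear0r ?(mulr0, subr0).
rewrite /c divfK ?subrr ?mulr0 //.
by apply: contra_neq w0 => /dot_eq0.
Qed.

Lemma orthov_cap0 U x : x \in U -> x \in orthov dot U -> x = 0.
Proof. by move=> xU /mem_orthovP/(_ _ xU)/dot_eq0. Qed.

Lemma orthov_cover U : (U + orthov dot U)%VS = fullv.
Proof.
apply/eqP; rewrite eqEsubv subvf /=; apply/subvP => x _.
have [u uU xu] := orth_decomp U x.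
by rewrite -(subrK u x) addrC memv_add.
Qed.

Lemma dim_orthov U : (\dim U + \dim (orthov dot U) = \dim {:E})%N.
Proof. by rewrite -(orthov_cover U) dimv_disjoint_sum // cap_orthov. Qed.

Lemma orthovK U : orthov dot (orthov dot U) = U.
Proof.
apply/eqP; rewrite eqEsubv; apply/andP; split; apply/subvP => x xU.
  have [u uU xu] := orth_decomp U x.
  suff /dot_eq0/eqP : dot (x - u) (x - u) = 0 by rewrite subr_eq0 => /eqP ->.
  have xxu : dot x (x - u) = 0 by move/mem_orthovP: xU; apply.
  have uxu : dot u (x - u) = 0 by rewrite dotC; move/mem_orthovP: xu; apply.
  by rewrite linearBl /= xxu uxu subr0.
by apply/mem_orthovP => y /mem_orthovP yU; exact: etrans (dotC x y) (yU _ xU).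
Qed.

Lemma basis_expand U (b : (\dim U).-tuple E) (t : 'I_(\dim U) -> R) i :
  basis_of U b -> coord b i (\sum_(j < \dim U) t j *: b`_j) = t i.
Proof. by move=> /basis_free bf; exact: coord_sum_free. Qed.

(** The Gram matrix of b is invertible since the form is definite, and the
    columns of its inverse are the coordinates of the dual basis. *)
Lemma dual_basis U (b : (\dim U).-tuple E) : basis_of U b ->
  exists Y : 'I_(\dim U) -> E, [/\ forall j, Y j \in U,
    forall i j : 'I_(\dim U), dot b`_i (Y j) = (i == j)%:R,
    forall x, x \in U -> x = \sum_(j < \dim U) dot x (Y j) *: b`_j &
    forall x, x \in U -> x = \sum_(j < \dim U) dot x b`_j *: Y j].
Proof.
move=> bU.
have bmem (i : 'I_(\dim U)) : b`_i \in U.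
  by apply: (basis_mem bU); rewrite mem_nth ?size_tuple.
have bnd x : x \in U -> (forall i : 'I_(\dim U), dot x b`_i = 0) -> x = 0.
  move=> xU x0; apply: dot_eq0; rewrite {2}(coord_basis bU xU) linear_sumr big1 // => i _.
  by rewrite linearZr_LR /= x0 mulr0.
pose G : 'M[R]_(\dim U) := \matrix_(i, j) dot b`_i b`_j.
have uG : G \in unitmx.
  rewrite -row_free_unit; apply: inj_row_free => v vG.
  pose x := \sum_(i < \dim U) v 0 i *: b`_i.
  have x0 : x = 0.
    apply: bnd => [|j]; first by apply: memv_suml => i _; exact: memvZ.
    transitivity ((v *m G) 0 j); last by rewrite vG mxE.
    rewrite mxE linear_sumlz; apply: eq_bigr => i _.
    by rewrite linearZl_LR /= mxE.
  apply/rowP => i; rewrite -(basis_expand (v 0) i bU) -/x x0 mxE.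
  exact: linear0.
pose Y (j : 'I_(\dim U)) := \sum_(k < \dim U) (invmx G) k j *: b`_k.
have YU j : Y j \in U by apply: memv_suml => k _; exact: memvZ.
have bY (i j : 'I_(\dim U)) : dot b`_i (Y j) = (i == j)%:R.
  transitivity ((G *m invmx G) i j); last by rewrite mulmxV // mxE.
  rewrite mxE linear_sumr; apply: eq_bigr => k _.
  by rewrite linearZr_LR /= mxE mulrC.
exists Y; split=> // x xU.
  rewrite {1}(coord_basis bU xU); apply: eq_bigr => j _; congr (_ *: _).
  rewrite {2}(coord_basis bU xU) linear_sumlz (bigD1 j) //= big1 => [|i ij].
    by rewrite linearZl_LR /= bY eqxx mulr1 addr0.
  by rewrite linearZl_LR /= bY (negPf ij) mulr0.
apply/eqP; rewrite -subr_eq0; apply/eqP; apply: bnd.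
  by rewrite memvB // memv_suml // => j _; exact: memvZ.
move=> i; rewrite linearBl /= linear_sumlz (bigD1 i) //= big1 => [|j ji].
  by rewrite linearZl_LR /= [dot (Y i) _]dotC bY eqxx mulr1 addr0 subrr.
by rewrite linearZl_LR /= [dot (Y j) _]dotC bY eq_sym (negPf ji) mulr0.
Qed.

End Duality.

(** * Lattices and dual lattices *)

Section LatticeDuality.
Context {R : realType} {E : vectType R} (dot : {dot E for idfun}).
Implicit Types (U V F : {vspace E}) (x y : E) (L S : set E).

Lemma lspan_sub S x : S x -> x \in lspan S.
Proof. by move=> Sx; have [+ _] := projT2 (cid (is_lspan_exists S)); apply. Qed.

Lemma lspan_min S U : (forall x, S x -> x \in U) -> (lspan S <= U)%VS.
Proof.
by move=> SU; have [_ minS] := projT2 (cid (is_lspan_exists S)); apply: minS => x /SU.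
Qed.

(** A free family in S of maximal length spans the span of S. *)
Lemma lspan_basis S : exists2 X : (\dim (lspan S)).-tuple E,
  basis_of (lspan S) X & forall i : 'I_(\dim (lspan S)), S X`_i.
Proof.
pose P n := `[< exists2 X : seq E, free X /\ size X = n & forall x, x \in X -> S x >].
have exP : exists n, P n by exists 0%N; apply/asboolP; exists [::] => //; rewrite nil_free.
have ubP n : P n -> (n <= \dim {:E})%N.
  move=> /asboolP[X [fX <-] _]; rewrite -(eqP (_ : \dim <<X>> == size X)%VS) //.
  by rewrite dimvS // subvf.
case: (ex_maxnP exP ubP) => n /asboolP[X [fX sX] XS] maxn.
have spanX : <<X>>%VS = lspan S.
  apply/eqP; rewrite eqEsubv; apply/andP; split.
    by apply/span_subvP => x /XS /lspan_sub.
  apply: lspan_min => x Sx; apply/negPn/negP => xX.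
  suff /maxn : P n.+1 by rewrite ltnn.
  apply/asboolP; exists (x :: X); first by rewrite free_cons xX fX /= sX.
  by move=> y; rewrite inE => /orP[/eqP ->|/XS].
have szX : size X == \dim (lspan S) by rewrite -spanX eq_sym.
exists (Tuple szX) => [|i]; first by rewrite /basis_of /= spanX eqxx fX.
by apply: XS; rewrite /= mem_nth ?(eqP szX).
Qed.

Lemma lattice_comb U L (I : finType) (P : pred I) (f : I -> E) (z : I -> int) :
  is_lattice U L -> (forall i, P i -> L (f i)) -> L (\sum_(i | P i) f i *~ z i).
Proof.
move=> [b [bU ->]] Lf; elim/big_rec : _ => [|i x Pi [zx ->]].
  by exists (fun=> 0); rewrite big1.
have [zi ->] := Lf i Pi.
exists (fun j => zi j * z i + zx j); rewrite mulrz_suml -big_split; apply: eq_bigr => j _.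
by rewrite mulrzDr mulrzA.
Qed.

Lemma latticeB U L x y : is_lattice U L -> L x -> L y -> L (x - y).
Proof.
move=> [b [bU ->]] [z ->] [z' ->]; exists (fun i => z i - z' i).
by rewrite -sumrB; apply: eq_bigr => i _; rewrite mulrzBr.
Qed.

Lemma latticeD U L x y : is_lattice U L -> L x -> L y -> L (x + y).
Proof.
move=> lL Lx Ly; rewrite -[y]opprK; apply: (latticeB lL Lx).
by have := latticeB lL Ly Ly; rewrite subrr => L0; rewrite -sub0r; exact: latticeB lL L0 Ly.
Qed.

Lemma lattice_basis_mem U L (b : (\dim U).-tuple E) (i : 'I_(\dim U)) :
  lattice_basis L b -> L b`_i.
Proof.
move=> [bU ->]; exists (fun j => (i == j)%:R).
rewrite (bigD1 i) //= eqxx big1 ?addr0 // => j ji.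
by rewrite eq_sym (negPf ji).
Qed.

(** Expand a basis of V made of elements of the dual section in the dual basis
    of L, and put the integer matrix of its coefficients in Smith normal form
    P *m D *m Q.  The rows of Q give a new basis Y of the dual lattice.  The
    matrix P being invertible over the integers, the multiple of Y_i by the
    i-th diagonal entry of D lies in V, and this entry is not zero as the rows
    are independent; so Y_i is in V for i < dim V. *)
Lemma adapted_bases F L : is_lattice fullv L ->
  let V := lspan (dual_section dot F L) in
  exists bb Y : 'I_(\dim {:E}) -> E, [/\ forall j, L (bb j),
    forall j x, L x -> dot x (Y j) \is a Num.int,
    forall i j, dot (bb i) (Y j) = (i == j)%:R &
    forall i : 'I_(\dim {:E}), (i < \dim V)%N -> Y i \in V].
Proof.
move=> lL V; have [b bL] := lL; have [bE LE] := bL.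
have [Y0 [_ bY _ exp2]] := dual_basis dot bE.
have [X XV XS] := lspan_basis (dual_section dot F L); rewrite -/V in X XV XS.
set n := \dim {:E}; set r := \dim V.
have rn : (r <= n)%N by rewrite dimvS // subvf.
have intA (i : 'I_r) (j : 'I_n) : dot X`_i b`_j \is a Num.int.
  by have [[_ Xi] _] := XS i; apply: Xi; exact: lattice_basis_mem.
pose A : 'M[int]_(r, n) := \matrix_(i, j) Num.floor (dot X`_i b`_j).
have AE i j : (A i j)%:~R = dot X`_i b`_j.
  by rewrite mxE floorK.
have [P uP [Q uQ [d _ AQ]]] := int_Smith_normal_form A.
pose Y (j : 'I_n) := \sum_k (Q j k)%:~R *: Y0 k.
pose bb (j : 'I_n) := \sum_(k < n) b`_k *~ (invmx Q k j).
exists bb, Y; split.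
- by move=> j; apply: (lattice_comb _ lL) => k _; exact: lattice_basis_mem.
- move=> j x; rewrite LE => -[z ->]; rewrite linear_sumlz; apply: rpred_sum => k _.
  rewrite -scaler_int linearZl_LR /= rpredM ?rpred_int // /Y linear_sumr.
  apply: rpred_sum => l _; rewrite linearZr_LR /= bY.
  by apply: rpredM; [exact: intr_int|exact: rpred_nat].
- move=> i j; transitivity (((Q *m invmx Q) j i)%:~R : R); last first.
    by rewrite mulmxV // mxE eq_sym; case: eqP.
  rewrite mxE rmorph_sum linear_sumlz; apply: eq_bigr => k _.
  rewrite -scaler_int linearZl_LR /= /Y linear_sumr (bigD1 k) //= big1 => [|l lk].
    by rewrite linearZr_LR /= bY eqxx mulr1 addr0 rmorphM mulrC.
  by rewrite linearZr_LR /= bY eq_sym (negPf lk) mulr0.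
move=> i ir.
pose i' := Ordinal ir.
have XE (l : 'I_r) : X`_l = \sum_j (A l j)%:~R *: Y0 j.
  by rewrite [LHS]exp2 ?memvf //; apply: eq_bigr => j _; rewrite AE.
have key : \sum_(l < r) (invmx P i' l)%:~R *: X`_l = (d`_i)%:~R *: Y i.
  have PA : invmx P *m A = (\matrix_(i, j) (d`_i *+ (i == j :> nat))) *m Q.
    by rewrite AQ -mulmxA mulKmx.
  transitivity (\sum_j ((invmx P *m A) i' j)%:~R *: Y0 j).
    under eq_bigr do rewrite XE scaler_sumr.
    rewrite exchange_big; apply: eq_bigr => j _ /=.
    rewrite mxE rmorph_sum scaler_suml; apply: eq_bigr => l _.
    by rewrite scalerA rmorphM.
  rewrite PA scaler_sumr; apply: eq_bigr => j _; rewrite scalerA; congr (_ *: _).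
  rewrite mxE (bigD1 i) //= big1 => [|k ki].
    by rewrite mxE /= eqxx mulr1n addr0 rmorphM.
  by rewrite mxE /= (_ : (i == k :> nat) = false) ?mul0r //; apply/negbTE; rewrite eq_sym.
have XiV (l : 'I_r) : X`_l \in V by apply: (basis_mem XV); rewrite mem_nth ?size_tuple.
have kV : (d`_i)%:~R *: Y i \in V.
  by rewrite -key; apply: memv_suml => l _; exact: memvZ.
have [d0|d0] := eqVneq (d`_i) 0; last first.
  have := memvZ (d`_i)%:~R^-1 kV; rewrite scalerA mulVf ?scale1r //.
  by rewrite intr_eq0.
exfalso; move: key; rewrite d0 scale0r => key.
have : row i' (invmx P) = 0.
  apply/rowP => l; rewrite !mxE; apply: (@intr_inj R).
  rewrite -(basis_expand (fun l => (invmx P i' l)%:~R) l XV) key linear0.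
  by [].
move=> /(congr1 (mulmx^~ P)); rewrite -row_mul mulVmx // mul0mx.
by move/rowP/(_ i'); rewrite !mxE eqxx.
Qed.

End LatticeDuality.

(** * The rational subspace V *)

Lemma eq_ord_ltF n (i j : 'I_n) : (i < j)%N -> (i == j) = false.
Proof. by move=> ij; apply/negbTE; rewrite -val_eqE /= neq_ltn ij. Qed.

Section RationalSubspace.
Context {R : realType} {E : vectType R} (dot : {dot E for idfun}).
Context (F : {vspace E}) (L : set E) (lL : is_lattice fullv L).
Let V := lspan (dual_section dot F L).
Let W := orthov dot V.

Lemma lspan_dual_section_sub : (V <= F)%VS.
Proof. by apply: lspan_min => x [_]. Qed.

(** With bb and Y dual to each other and the first dim V vectors of Y spanning
    V, membership in V or in its orthogonal complement is read off from one
    block of coordinates. *)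
Lemma adapted_bases_split : exists bb Y : 'I_(\dim {:E}) -> E,
  [/\ forall j, L (bb j),
      forall j x, L x -> dot x (Y j) \is a Num.int,
      forall j : 'I_(\dim {:E}), (j < \dim V)%N -> dual_section dot F L (Y j),
      forall i j, dot (bb i) (Y j) = (i == j)%:R &
   [/\ forall x, x = \sum_j dot x (Y j) *: bb j,
      forall x, x = \sum_j dot x (bb j) *: Y j,
      forall x, x \in V <->
        forall j : 'I_(\dim {:E}), (\dim V <= j)%N -> dot x (bb j) = 0 &
      forall x, x \in W <->
        forall j : 'I_(\dim {:E}), (j < \dim V)%N -> dot x (Y j) = 0]].
Proof.
have [bb [Y [Lbb LY bY YV]]] := adapted_bases dot F lL.
exists bb, Y; split=> // [j jr|].
  split; last by apply: (subvP lspan_dual_section_sub); exact: YV.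
  by split; [exact: memvf|move=> y Ly; rewrite dotC; exact: LY].
pose bt := [tuple bb i | i < \dim {:E}].
have btE (i : 'I_(\dim {:E})) : bt`_i = bb i by rewrite -tnth_nth tnth_mktuple.
have fb : free bt.
  apply/freeP => k k0 i; have := congr1 (dot^~ (Y i)) k0.
  rewrite linear0l linear_sumlz (bigD1 i) //= big1 => [|j ji].
    by rewrite linearZl_LR /= btE bY eqxx mulr1 addr0.
  by rewrite linearZl_LR /= btE bY (negPf ji) mulr0.
have bE : basis_of fullv bt by rewrite basisEfree fb subvf size_tuple /=.
have [Y' [_ bY' exp1 exp2]] := dual_basis dot bE.
have YE j : Y' j = Y j.
  rewrite [RHS]exp2 ?memvf // (bigD1 j) //= btE [dot (Y j) _]dotC bY eqxx scale1r.
  rewrite big1 ?addr0 // => i ij.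
  by rewrite btE [dot (Y j) _]dotC bY (negPf ij) scale0r.
have e1 x : x = \sum_j dot x (Y j) *: bb j.
  by rewrite [LHS]exp1 ?memvf //; apply: eq_bigr => j _; rewrite YE btE.
have e2 x : x = \sum_j dot x (bb j) *: Y j.
  by rewrite [LHS]exp2 ?memvf //; apply: eq_bigr => j _; rewrite YE btE.
have rn : (\dim V <= \dim {:E})%N by rewrite dimvS // subvf.
pose yt := [tuple Y (widen_ord rn i) | i < \dim V].
have ytE (i : 'I_(\dim V)) : yt`_i = Y (widen_ord rn i).
  by rewrite -tnth_nth tnth_mktuple.
have fy : free yt.
  apply/freeP => k k0 i; have := congr1 (dot (bb (widen_ord rn i))) k0.
  rewrite linear0r linear_sumr (bigD1 i) //= big1 => [|j ji].
    by rewrite linearZr_LR /= ytE bY eqxx mulr1 addr0.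
  rewrite linearZr_LR /= ytE bY (_ : (_ == _) = false) ?mulr0 //.
  by apply/negbTE; rewrite -val_eqE /= eq_sym; exact: ji.
have yV : basis_of V yt.
  rewrite basisEfree fy size_tuple leqnn andbT /=; apply/span_subvP => _ /mapP[i _ ->].
  exact: (YV (widen_ord rn i) (ltn_ord i)).
have span x : x \in V -> exists k : 'I_(\dim V) -> R,
    x = \sum_(i < \dim V) k i *: Y (widen_ord rn i).
  move=> xV; exists (fun i => coord yt i x).
  by rewrite {1}(coord_basis yV xV); apply: eq_bigr => i _; rewrite ytE.
split=> // x; split.
- move=> /span[k ->] j rj; rewrite linear_sumlz big1 // => i _.
  rewrite linearZl_LR /= dotC bY eq_sym eq_ord_ltF ?mulr0 //.
  exact: leq_trans (ltn_ord i) rj.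
- move=> x0; rewrite [x]e2; apply: memv_suml => j _.
  have [rj|jr] := leqP (\dim V) j; first by rewrite x0 // scale0r mem0v.
  by rewrite memvZ // YV.
- by move=> /orthP xW j jr; apply: xW; exact: YV.
- move=> x0; apply/orthP => y /span[k ->]; rewrite linear_sumr big1 // => i _.
  by rewrite linearZr_LR /= (x0 (widen_ord rn i) (ltn_ord i)) mulr0.
Qed.

(** The products of g with the first dim V vectors of Y are integers; they are
    the coefficients of a lattice point on the first dim V vectors of bb. *)
Lemma fiber_nonempty g : dual_in dot V (dual_section dot F L) g ->
  exists2 x, L x & x - g \in W.
Proof.
move=> [gV gint].
have [bb [Y [Lbb LY YS bY [e1 e2 memV memW]]]] := adapted_bases_split.
exists (\sum_(j < \dim {:E} | (j < \dim V)%N) bb j *~ Num.floor (dot g (Y j))).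
  by apply: (lattice_comb _ lL) => j _.
apply/memW => j jr; rewrite linearBl /= linear_sumlz (bigD1 j) //= big1 => [|i /andP[ir ij]].
  by rewrite -scaler_int linearZl_LR /= bY eqxx mulr1 addr0 floorK ?subrr // gint //; exact: YS.
by rewrite -scaler_int linearZl_LR /= bY (negPf ij) mulr0.
Qed.

Lemma fiber_of x : L x ->
  exists2 g, dual_in dot V (dual_section dot F L) g & x - g \in W.
Proof.
move=> Lx; have [g gV xg] := orth_decomp dot V x.
exists g => //; split=> // y yS.
have -> : dot g y = dot x y.
  apply/eqP; rewrite eq_sym -subr_eq0 -linearBl /=; apply/eqP.
  by move/orthP: xg; apply; exact: lspan_sub.
by rewrite dotC; case: yS => -[_ yint] _; exact: yint.
Qed.

(** The last vectors of bb are orthogonal to V, and form a basis. *)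
Lemma orth_section_lattice : is_lattice W (L `&` [set` W]).
Proof.
have [bb [Y [Lbb LY YS bY [e1 e2 memV memW]]]] := adapted_bases_split.
have dW := dim_orthov dot V; rewrite -/W in dW.
have lt (i : 'I_(\dim W)) : (\dim V + i < \dim {:E})%N by rewrite -dW ltn_add2l.
pose up (i : 'I_(\dim W)) : 'I_(\dim {:E}) := Ordinal (lt i).
have [bt btE] : exists bt : (\dim W).-tuple E,
    forall i : 'I_(\dim W), bt`_i = bb (up i).
  by exists [tuple bb (up i) | i < \dim W] => i; rewrite -tnth_nth tnth_mktuple.
have bW (i : 'I_(\dim W)) : bb (up i) \in W.
  apply/memW => j jr; rewrite bY eq_sym eq_ord_ltF //.
  exact: leq_trans jr (leq_addr _ _).
have upinj : injective up by move=> i j [/addnI ij]; exact: val_inj.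
exists bt; split.
  rewrite basisEfree size_tuple leqnn andbT; apply/andP; split; last first.
    by apply/span_subvP => _ /tnthP[i ->]; rewrite (tnth_nth 0) btE.
  apply/freeP => k k0 i; have := congr1 (dot^~ (Y (up i))) k0.
  rewrite linear0l linear_sumlz (bigD1 i) //= big1 => [|j ji].
    by rewrite linearZl_LR /= btE bY eqxx mulr1 addr0.
  by rewrite linearZl_LR /= btE bY (inj_eq upinj) (negPf ji) mulr0.
apply/seteqP; split=> [x [Lx xW]|_ [z ->]].
  exists (fun i => Num.floor (dot x (Y (up i)))).
  set x' := \sum_(i < _) _; apply/eqP; rewrite -subr_eq0; apply/eqP.
  rewrite [LHS]e1 big1 // => j _; suff -> : dot (x - x') (Y j) = 0 by rewrite scale0r.
  have [jr|rj] := ltnP j (\dim V).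
    have /memW -> // : x - x' \in W.
    rewrite memvB // memv_suml // => i _.
    by rewrite -scaler_int memvZ // btE.
  have jW : (j - \dim V < \dim W)%N by rewrite ltn_subLR // dW.
  have {rj}-> : j = up (Ordinal jW) by apply: val_inj; rewrite /= subnKC.
  rewrite linearBl /= linear_sumlz (bigD1 (Ordinal jW)) //= big1 => [|i ij].
    rewrite -scaler_int linearZl_LR /= (btE (Ordinal jW)) bY eqxx mulr1 addr0 floorK ?subrr //.
    exact: LY.
  by rewrite -scaler_int linearZl_LR /= btE bY (inj_eq upinj) (negPf ij) mulr0.
split; last first.
  by apply: memv_suml => i _; rewrite -scaler_int memvZ // btE.
by apply: (lattice_comb _ lL) => i _; rewrite btE.
Qed.

(** A functional that is integral on the section of L by W extends to one that
    is integral on L: keep its values on the last vectors of bb and put 0 on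
    the first ones.  This changes y by an element of V, hence inside F, so the
    new vector is in the dual section and thus in V; then so is y, which is
    also orthogonal to V. *)
Lemma integral_on_section_eq0 y : y \in W -> y \in F ->
  (forall x, L x -> x \in W -> dot y x \is a Num.int) -> y = 0.
Proof.
move=> yW yF yint.
have [bb [Y [Lbb LY YS bY [e1 e2 memV memW]]]] := adapted_bases_split.
pose y' := \sum_(j < \dim {:E} | (\dim V <= j)%N) dot y (bb j) *: Y j.
have yV : y - y' \in V.
  apply/memV => j rj; rewrite linearBl /= linear_sumlz (bigD1 j) //= big1 => [|i /andP[ri ij]].
    by rewrite linearZl_LR /= [dot (Y j) _]dotC bY eqxx mulr1 addr0 subrr.
  by rewrite linearZl_LR /= [dot (Y i) _]dotC bY eq_sym (negPf ij) mulr0.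
have y'F : y' \in F.
  by rewrite -[y'](subKr y) memvB // (subvP lspan_dual_section_sub).
have y'V : y' \in V.
  apply: lspan_sub; split=> //; split; first exact: memvf.
  move=> x Lx; rewrite linear_sumlz; apply: rpred_sum => j rj.
  rewrite linearZl_LR /= rpredM //; last by rewrite dotC LY.
  apply: yint => //; apply/memW => i ir; rewrite bY eq_sym eq_ord_ltF //.
  exact: leq_trans ir rj.
apply: (@orthov_cap0 _ _ dot V) => //.
by rewrite -(subrK y' y) memvD.
Qed.

(** A vector of V is determined by its products with the first dim V vectors
    of Y, here integers bounded in terms of M. *)
Lemma dual_section_finite (M : R) :
  finite_set [set g | dual_in dot V (dual_section dot F L) g /\ dot g g <= M].
Proof.
have [bb [Y [Lbb LY YS bY [e1 e2 memV memW]]]] := adapted_bases_split.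
pose n := \dim {:E}.
pose D := \sum_(j < n) (`|M| + dot (Y j) (Y j)).
have Yint g (j : 'I_n) : dual_in dot V (dual_section dot F L) g ->
    (j < \dim V)%N -> dot g (Y j) \is a Num.int.
  by move=> [_ gint] jr; apply: gint; exact: YS.
pose f g : 'rV[int]_n := \row_j Num.floor (if (j < \dim V)%N then dot g (Y j) else 0).
have [] // := @cnt_image_le _ _ f
   [set g | dual_in dot V (dual_section dot F L) g /\ dot g g <= M] _
   (finite_int_points (const_mx (- D) : 'rV[R]_n) (const_mx (D + 1))).
  move=> g1 g2; rewrite !inE => -[g1S _] [g2S _] /rowP f12.
  apply/eqP; rewrite -subr_eq0; apply/eqP; apply: (@orthov_cap0 _ _ dot V).
    by rewrite memvB //; [case: g1S|case: g2S].
  apply/memW => j jr; rewrite linearBl /=; apply/eqP; rewrite subr_eq0; apply/eqP.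
  have := f12 j; rewrite !mxE jr => /(congr1 (fun z => z%:~R : R)).
  by rewrite !floorK ?Yint.
move=> g [gS gM] j.
have D0 : 0 <= D by apply: sumr_ge0 => i _; rewrite addr_ge0 // dot_ge0.
rewrite !mxE; case: ifPn => jr; last by rewrite floor0 mulr0z; apply/andP; split; lra.
rewrite floorK ?Yint //.
have : dot g g + dot (Y j) (Y j) <= D.
  rewrite /D (bigD1 j) //= ler_wpDr ?lerD2r ?(le_trans gM) ?ler_norm //.
  by apply: sumr_ge0 => i _; rewrite addr_ge0 // dot_ge0.
have := dot_ge0 dot (g - Y j); have := dot_ge0 dot (g + Y j).
rewrite !(linearDl, linearDr, linearNl, linearNr) /=.
rewrite [dot (Y j) g]dotC; set a := dot g g; set b := dot (Y j) (Y j); set c := dot g (Y j).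
by move=> h1 h2 h3; apply/andP; split; lra.
Qed.

End RationalSubspace.

(** * Coordinates on a subspace *)

Section Coordinates.
Context {R : realType} {E : vectType R}.
Implicit Types (U : {vspace E}).

Definition comb U (b : (\dim U).-tuple E) (s : 'rV[R]_(\dim U)) : E :=
  \sum_(i < \dim U) s 0 i *: b`_i.

Definition coordmx U (e b : (\dim U).-tuple E) : 'M[R]_(\dim U) :=
  \matrix_(i, j) coord e j b`_i.

Lemma basis_nth_mem U (b : (\dim U).-tuple E) (i : 'I_(\dim U)) :
  basis_of U b -> b`_i \in U.
Proof. by move=> bU; apply: (basis_mem bU); rewrite mem_nth ?size_tuple. Qed.

Lemma comb_mem U (b : (\dim U).-tuple E) s : basis_of U b -> comb b s \in U.
Proof. by move=> bU; apply: memv_suml => i _; rewrite memvZ // basis_nth_mem. Qed.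

Lemma combD U (b : (\dim U).-tuple E) s t : comb b (s + t) = comb b s + comb b t.
Proof.
by rewrite /comb -big_split; apply: eq_bigr => i _; rewrite mxE scalerDl.
Qed.

Lemma comb_inj U (b : (\dim U).-tuple E) : basis_of U b -> injective (comb b).
Proof.
move=> bU s t st; apply/rowP => i.
by rewrite -(basis_expand (s 0) i bU) -(basis_expand (t 0) i bU) -/(comb b s) st.
Qed.

Lemma comb_coord U (b : (\dim U).-tuple E) x : basis_of U b -> x \in U ->
  x = comb b (\row_i coord b i x).
Proof.
move=> bU xU; rewrite {1}(coord_basis bU xU).
by apply: eq_bigr => i _; rewrite mxE.
Qed.

Lemma comb_coordmx U (e b : (\dim U).-tuple E) s : basis_of U e -> basis_of U b ->
  comb b s = comb e (s *m coordmx e b).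
Proof.
move=> eU bU; rewrite /comb.
under eq_bigr => i _ do
  rewrite (coord_basis eU (basis_nth_mem i bU)) scaler_sumr.
rewrite exchange_big; apply: eq_bigr => j _ /=.
rewrite mxE scaler_suml; apply: eq_bigr => i _.
by rewrite mxE scalerA.
Qed.

Lemma coordmxM U (e b c : (\dim U).-tuple E) :
  basis_of U e -> basis_of U b -> basis_of U c ->
  coordmx b c *m coordmx e b = coordmx e c.
Proof.
move=> eU bU cU; apply/row_matrixP => i; rewrite !rowE; apply: (comb_inj eU).
by rewrite -comb_coordmx // mulmxA -!comb_coordmx.
Qed.

Lemma coordmx_id U (e : (\dim U).-tuple E) : basis_of U e -> coordmx e e = 1%:M.
Proof.
move=> eU; apply/row_matrixP => i; rewrite !rowE; apply: (comb_inj eU).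
by rewrite -comb_coordmx // mulmx1.
Qed.

Lemma coordmx_unit U (e b : (\dim U).-tuple E) : basis_of U e -> basis_of U b ->
  coordmx e b \in unitmx.
Proof.
move=> eU bU; have H : coordmx e b *m coordmx b e = 1%:M.
  by rewrite coordmxM // coordmx_id.
by have [] := mulmx1_unit H.
Qed.

Lemma coordmxV U (e b : (\dim U).-tuple E) : basis_of U e -> basis_of U b ->
  invmx (coordmx e b) = coordmx b e.
Proof.
move=> eU bU; apply: (can_inj (mulmxK (coordmx_unit eU bU))).
by rewrite mulVmx ?coordmx_unit // coordmxM // coordmx_id.
Qed.

Lemma onb_basis (dot : {dot E for idfun}) U : basis_of U (onb dot U).
Proof.
rewrite /onb; case: xgetP => [x _ /andP[]//|_]; exact: vbasisP.
Qed.

Lemma lattice_basis_comb U (L : set E) (b : (\dim U).-tuple E) x :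
  lattice_basis L b -> L x <-> exists z : 'rV[int]_(\dim U), x = comb b (map_mx intr z).
Proof.
move=> [_ ->]; split=> [[z ->]|[z ->]].
  by exists (\row_i z i); apply: eq_bigr => i _; rewrite !mxE scaler_int.
by exists (z 0); apply: eq_bigr => i _; rewrite !mxE scaler_int.
Qed.

(** In the coordinates of the chart the fundamental domain of b is the cell of
    the matrix of b.  The basis b is the one picked in the definition of the
    covolume, so that no comparison of two bases of L is needed. *)
Lemma covol_cellvol (dot : {dot E for idfun}) U (L : set E) : is_lattice U L ->
  exists2 b : (\dim U).-tuple E, lattice_basis L b &
    covol dot U L = cellvol (coordmx (onb dot U) b).
Proof.
move=> [b0 b0L]; pose b := xget (vbasis U) [set b | lattice_basis L b].
have bL : lattice_basis L b by rewrite /b; case: xgetP => // /(_ b0).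
exists b => //; rewrite /covol -/b /vol_in; congr outer_content.
have eU := onb_basis dot U; have bU := bL.1.
have uB := coordmx_unit eU bU.
apply/seteqP; split=> t.
  move=> [s [s01 ts]]; pose s' : 'rV[R]_(\dim U) := \row_i s i.
  have tE : t = s' *m coordmx (onb dot U) b.
    apply: (comb_inj eU); rewrite -comb_coordmx // /comb.
    move: ts; rewrite /chart add0r => ->.
    by apply: eq_bigr => i _; rewrite mxE.
  by move=> i; rewrite tE mulmxK // mxE.
move=> tc; exists (fun i => (t *m invmx (coordmx (onb dot U) b)) 0 i); split=> //.
rewrite /chart add0r -/(comb b _) -/(comb (onb dot U) t).
by rewrite (comb_coordmx _ eU bU) mulmxKV.
Qed.

End Coordinates.

(** * The dilation *)

Section Dilation.
Context {R : realType} {E : vectType R} (dot : {dot E for idfun}) (F : {vspace E}).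
Let H := orthov dot F.

Lemma dilationD eps x y : dilation dot F eps (x + y) =
  dilation dot F eps x + dilation dot F eps y.
Proof. by rewrite /dilation !linearD /= addrACA. Qed.

Lemma dilationZ eps c x : dilation dot F eps (c *: x) = c *: dilation dot F eps x.
Proof. by rewrite /dilation !linearZ /= scalerDr !scalerA mulrC. Qed.

Lemma dilation_sum eps (I : finType) (f : I -> E) :
  dilation dot F eps (\sum_i f i) = \sum_i dilation dot F eps (f i).
Proof.
elim/big_ind2: _ => [|x1 y1 x2 y2 <- <-|//]; last by rewrite dilationD.
by rewrite /dilation !linear0 ?scaler0 addr0.
Qed.

Lemma dilation_split eps f h : f \in F -> h \in H ->
  dilation dot F eps (f + h) = f + eps^-1 *: h.
Proof. by move=> fF hH; rewrite dilationD dilation_id // dilation_orthov. Qed.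

Lemma dilation_inj eps : 0 < eps -> injective (dilation dot F eps).
Proof.
move=> e0 x y.
have [f fF xH] := orth_decomp dot F x; have [f' f'F yH] := orth_decomp dot F y.
rewrite -[x](subrK f) -[y](subrK f') ![_ + f]addrC ![_ + f']addrC.
rewrite !dilation_split // => fh.
have capE : f - f' = eps^-1 *: (y - f') - eps^-1 *: (x - f).
  by apply/eqP; rewrite subr_eq addrAC eq_sym subr_eq addrC -fh addrC.
have ff' : f - f' = 0.
  apply: (@orthov_cap0 _ _ dot F); first exact: memvB.
  by rewrite capE memvB // memvZ.
move: capE; rewrite ff' => /esym/eqP; rewrite subr_eq0 => /eqP.
have e0' : eps^-1 != 0 by rewrite invr_eq0 gt_eqF.
move=> /(scalerI e0') ->; congr (_ + _).
by apply/eqP; rewrite -subr_eq0 ff'.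
Qed.

Lemma dilation_subH eps x : dilation dot F eps x - x \in H.
Proof.
have [f fF xH] := orth_decomp dot F x.
rewrite -[x](subrK f) [_ + f]addrC dilation_split // opprD addrACA subrr add0r.
by rewrite memvB // memvZ.
Qed.

Context (W : {vspace E}) (HW : (H <= W)%VS).

Lemma sub_decomp : (W :&: F + H)%VS = W.
Proof.
apply/eqP; rewrite eqEsubv subv_add capvSl HW /=; apply/subvP => x xW.
have [f fF xH] := orth_decomp dot F x.
rewrite -[x](subrK f) addrC memv_add // memv_cap fF andbT.
by rewrite -[f](subKr x) memvB // (subvP HW).
Qed.

Lemma sub_decomp_dim : (\dim (W :&: F) + \dim H = \dim W)%N.
Proof.
rewrite -{2}sub_decomp dimv_disjoint_sum //; apply/eqP; rewrite -subv0.
apply/subvP => x; rewrite !memv_cap memv0 => /andP[/andP[_ xF] xH].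
by apply/eqP; exact: (@orthov_cap0 _ _ dot F).
Qed.

(** A basis of W on which the dilation is diagonal: a basis of the part of W
    in F, then one of H. *)
Lemma dilation_adapted_basis : exists p : (\dim W).-tuple E,
  [/\ basis_of W p,
     forall i : 'I_(\dim W), (i < \dim (W :&: F))%N -> p`_i \in F,
     forall i : 'I_(\dim W), (\dim (W :&: F) <= i)%N -> p`_i \in H &
     forall y, (forall i : 'I_(\dim W), (\dim (W :&: F) <= i)%N -> dot p`_i y = 0) ->
       forall h, h \in H -> dot h y = 0].
Proof.
pose s := vbasis (W :&: F) ++ vbasis H.
have sz : size s == \dim W by rewrite size_cat !size_tuple sub_decomp_dim.
exists (Tuple sz); split.
- rewrite basisEdim /= size_cat !size_tuple sub_decomp_dim leqnn andbT.
  by rewrite span_cat !(span_basis (vbasisP _)) sub_decomp.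
- move=> i iF; rewrite /= nth_cat size_tuple iF.
  have : (vbasis (W :&: F))`_i \in (W :&: F)%VS.
    by apply: vbasis_mem; rewrite mem_nth ?size_tuple.
  by rewrite memv_cap => /andP[].
- move=> i iF; rewrite /= nth_cat size_tuple ltnNge iF /=.
  apply: vbasis_mem; rewrite mem_nth // size_tuple ltn_subLR //.
  by rewrite sub_decomp_dim.
move=> y py h hH; rewrite (coord_vbasis hH) linear_sumlz big1 // => j _.
rewrite linearZl_LR /=.
have ji : (\dim (W :&: F) + j < \dim W)%N by rewrite -sub_decomp_dim ltn_add2l.
have := py (Ordinal ji); rewrite /= nth_cat size_tuple ltnNge leq_addr /= addKn.
by move=> ->; rewrite ?mulr0 ?leq_addr.
Qed.

Lemma card_ge_ord (k n d : nat) : (k + n)%N = d ->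
  #|[pred i : 'I_d | (k <= i)%N]| = n.
Proof.
move=> <-; rewrite -sum1_card big_split_ord /= big1 ?add0n => [|i]; last first.
  by rewrite inE /= leqNgt ltn_ord.
by rewrite (eq_bigl predT) => [|i]; rewrite ?sum1_card ?card_ord // inE /= leq_addr.
Qed.

Lemma dilation_contraction (p : (\dim W).-tuple E) eps :
  0 < eps ->
  (forall i : 'I_(\dim W), (i < \dim (W :&: F))%N -> p`_i \in F) ->
  (forall i : 'I_(\dim W), (\dim (W :&: F) <= i)%N -> p`_i \in H) ->
  forall u, dilation dot F eps (comb p (u *m diag_mx
    (contraction [pred i : 'I_(\dim W) | (\dim (W :&: F) <= i)%N] eps))) = comb p u.
Proof.
move=> e0 pF pH u; rewrite dilation_sum; apply: eq_bigr => i _.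
rewrite mul_mx_diag !mxE dilationZ /=; case: ifPn => iF.
  by rewrite dilation_orthov ?pH // scalerA mulfK // gt_eqF.
by rewrite dilation_id ?mulr1 // pF // ltnNge.
Qed.

End Dilation.

(** * Points of the lattice above a point of V *)

Section Fibers.
Context {R : realType} {E : vectType R} (dot : {dot E for idfun}).
Context (F : {vspace E}) (L S : set E) (lL : is_lattice fullv L).
Let H := orthov dot F.
Let V := lspan (dual_section dot F L).
Let W := orthov dot V.
Let Ldual := dual_in dot V (dual_section dot F L).

Definition fiber (eps : R) (g : E) : set E :=
  (dilation dot F eps @` S `&` L) `&` [set y | y - g \in W].

Lemma H_sub_W : (H <= W)%VS.
Proof.
apply/subvP => x /orthP xF; apply/orthP => v vV; apply: xF.
exact: (subvP (lspan_dual_section_sub dot F L)).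
Qed.

Lemma chart_inj g : injective (chart dot W g).
Proof. by move=> s t /addrI; apply: comb_inj; exact: onb_basis. Qed.

(** With B the matrix of a basis of the section of L by W, and P that of a
    basis diagonalizing the dilation, the points above g are the images of a
    coset of the lattice with basis matrix B *m M, where M is the inverse of
    the dilation.  The independence condition on B and P says that no nonzero
    dual vector of the section is orthogonal to H. *)
Lemma fiberE g : Ldual g ->
  exists (B P : 'M[R]_(\dim W)) (u : 'rV[R]_(\dim W)),
  let h := [pred i : 'I_(\dim W) | (\dim (W :&: F) <= i)%N] in
  [/\ B \in unitmx, P \in unitmx, covol dot W (L `&` [set` W]) = cellvol B,
     forall a : 'rV[int]_(\dim W), a != 0 ->
       exists2 i, h i & (map_mx intr a *m (P *m invmx B)^T) 0 i != 0 &
     forall eps, 0 < eps ->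
       let M := invmx P *m diag_mx (contraction h eps) *m P in
       fiber eps g = (dilation dot F eps \o chart dot W g) @`
         (lattice_coset (u *m M) (B *m M) `&` (chart dot W g @^-1` S))].
Proof.
move=> Lg.
have [b bL covE] := covol_cellvol dot (orth_section_lattice dot F lL).
have [p [pW pF pH pdot]] := dilation_adapted_basis H_sub_W.
set e := onb dot W in covE; have eW : basis_of W e by exact: onb_basis.
have bW : basis_of W b := bL.1.
have [x0 Lx0 x0g] := fiber_nonempty lL Lg.
pose u : 'rV[R]_(\dim W) := \row_i coord e i (x0 - g).
have uE : x0 - g = comb e u by exact: comb_coord.
exists (coordmx e b), (coordmx e p), u; move=> h.
have uB : coordmx e b \in unitmx by exact: coordmx_unit.
have uP : coordmx e p \in unitmx by exact: coordmx_unit.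
split=> // [a a0|eps eps0 M].
  have [Y [YW bY exp1 exp2]] := dual_basis dot bW.
  pose y := \sum_(j < \dim W) (a 0 j)%:~R *: Y j.
  have yb (j : 'I_(\dim W)) : dot y b`_j = (a 0 j)%:~R.
    rewrite linear_sumlz (bigD1 j) //= big1 => [|i ij].
      by rewrite linearZl_LR /= dotC bY eqxx mulr1 addr0.
    by rewrite linearZl_LR /= dotC bY eq_sym (negPf ij) mulr0.
  have yW : y \in W by apply: memv_suml => j _; rewrite memvZ.
  have pE (i : 'I_(\dim W)) :
      (map_mx intr a *m (coordmx e p *m invmx (coordmx e b))^T) 0 i = dot p`_i y.
    rewrite coordmxV // coordmxM // mxE linear_sumr; apply: eq_bigr => j _.
    rewrite linearZr_LR /= !mxE; congr (_ * _).
    rewrite {1}[p`_i]exp1; first exact: basis_expand.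
    exact: basis_nth_mem.
  apply: contrapT => nex; move/eqP: a0; apply.
  have y0 : y = 0.
    apply: (@integral_on_section_eq0 _ _ dot F L lL) => //.
      rewrite -(orthovK dot F); apply/orthP => h' h'H; rewrite dotC.
      apply: pdot h'H => i iF; apply/eqP; apply/negPn/negP => pi0; apply: nex.
      by exists i => //; rewrite pE.
    move=> x Lx xW.
    have /(lattice_basis_comb _ bL)[z ->] : (L `&` [set` W]) x by [].
    rewrite linear_sumr; apply: rpred_sum => j _.
    by rewrite linearZr_LR /= yb mxE rpredM // intr_int.
  apply/rowP => j; apply: (@intr_inj R).
  by rewrite -yb y0 linear0l mxE.
have dilE t : dilation dot F eps (comb e (t *m M)) = comb e t.
  pose v := t *m invmx (coordmx e p).
  have -> : comb e (t *m M) = comb p (v *m diag_mx (contraction h eps)).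
    by rewrite (comb_coordmx _ eW pW) !mulmxA.
  by rewrite dilation_contraction // (comb_coordmx _ eW pW) mulmxKV.
(* from here on only the relation dilE between M and the dilation matters *)
clearbody M.
have gF : g \in F by apply: (subvP (lspan_dual_section_sub dot F L)); case: Lg.
have dilchart t : dilation dot F eps (chart dot W g (t *m M)) = g + comb e t.
  by rewrite /chart -/(comb e _) dilationD dilation_id // dilE.
have uz z : g + comb e (u + map_mx intr z *m coordmx e b) = x0 + comb b (map_mx intr z).
  by rewrite combD -uE addrA addrCA subrr addr0 (comb_coordmx _ eW bW).
have Lcomb z : (L `&` [set` W]) (comb b (map_mx intr z)).
  by apply/(lattice_basis_comb _ bL); exists z.
apply/seteqP; split=> [y [[[x Sx xy] Ly] yg]|_ [t [[z tz] St] <-]].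
  have yx0 : (L `&` [set` W]) (y - x0).
    split; last first.
      rewrite /= (_ : y - x0 = (y - g) - (x0 - g)); first exact: memvB.
    by rewrite opprB addrA subrK.
    exact: latticeB lL Ly Lx0.
  have /(lattice_basis_comb _ bL)[z zE] := yx0.
  have yE : y = dilation dot F eps
      (chart dot W g ((u + map_mx intr z *m coordmx e b) *m M)).
    by rewrite dilchart uz -zE addrC subrK.
  exists ((u + map_mx intr z *m coordmx e b) *m M) => //; split.
    by exists z; rewrite mulmxDl mulmxA.
  rewrite /preimage /=.
  have -> // : chart dot W g ((u + map_mx intr z *m coordmx e b) *m M) = x.
  by apply: (dilation_inj eps0); exact: etrans (esym yE) (esym xy).
have tE : t = (u + map_mx intr z *m coordmx e b) *m M.
  by rewrite tz mulmxDl mulmxA.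
rewrite /= tE dilchart uz.
have [Lz Wz] := Lcomb z.
split; last by rewrite /= addrAC memvD.
split; first by exists (chart dot W g t) => //; rewrite tE dilchart uz.
exact: latticeD lL Lx0 Lz.
Qed.

Lemma fiber_cnt_cvg g : Ldual g -> jordan_measurable_in dot W g S ->
  (forall eps, 0 < eps -> finite_set (fiber eps g)) /\
  eps ^+ \dim H * (cnt (fiber eps g))%:R @[eps --> 0^'+] -->
    vol_in dot W g S / covol dot W (L `&` [set` W]).
Proof.
move=> Lg jS; have [B [P [u [uB uP -> indep fE]]]] := fiberE Lg.
set h := [pred i : 'I_(\dim W) | (\dim (W :&: F) <= i)%N] in indep fE.
have ch : #|h| = \dim H.
  exact: card_ge_ord (sub_decomp_dim H_sub_W).
pose M eps := invmx P *m diag_mx (contraction h eps) *m P.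
have fin eps : 0 < eps -> finite_set (lattice_coset (u *m M eps) (B *m M eps) `&`
    (chart dot W g @^-1` S)).
  move=> e0; have [[a [b ab]] _] := jS.
  have uN : B *m M eps \in unitmx.
    rewrite !unitmx_mul uB unitmx_inv uP diag_mx_unit // => i.
    exact: contraction_gt0.
  have fb := lattice_coset_finite (u *m M eps) uN a b.
  by apply: sub_finite_set fb => t [Xt /ab tab]; split.
split=> [eps e0|]; first by rewrite fE //; exact: finite_image (fin _ e0).
have := contracted_lattice_cvg (fun eps => u *m M eps) uB uP indep jS.
rewrite ch; apply: cvg_trans; apply: near_eq_cvg; near=> eps.
have e0 : 0 < eps by near: eps; exact: nbhs_right_gt.
rewrite fE // cnt_image //; last exact: fin.
by apply: inj_comp; [exact: dilation_inj|exact: chart_inj].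
Unshelve. all: by end_near.
Qed.

End Fibers.

(** * The asymptotic count *)

(** A zero volume thus forces an open slice to be empty; the equivalence
    asserted below needs this when its right-hand side vanishes. *)
Lemma outer_content_open_gt0 {R : realType} {m : nat} (A : set 'rV[R]_m) :
  open A -> (exists a b, A `<=` box a b) -> A !=set0 -> 0 < outer_content A.
Proof.
move=> oA bA [t At].
have /nbhs_ballP[r /= r0 rA] : nbhs t A by exact: open_nbhs_nbhs.
pose a := t - const_mx (r / 2); pose b := t + const_mx (r / 2).
have ab i : a 0 i < b 0 i by rewrite !mxE; lra.
have abA : box a b `<=` A.
  move=> y yab; apply: rA; split=> // i j.
  have := yab j; rewrite !ord1 !mxE /ball /= ltr_distlC.
  by move=> /andP[h1 h2]; apply/andP; split; lra.
apply: lt_le_trans (_ : box_vol a b <= _); last first.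
  apply: inner_sums_le_outer_content => //; apply: inner_sums_sub abA _.
  by apply: inner_sums_box => i; exact: ltW.
by apply: prodr_gt0 => i _; rewrite subr_gt0.
Qed.

Lemma outer_content0 {R : realType} {m : nat} : outer_content (set0 : set 'rV[R]_m) = 0.
Proof.
have o0 : outer_sums (set0 : set 'rV[R]_m) 0.
  exists 0%N, (fun=> 0), (fun=> 0); split=> //; last by rewrite big_ord0.
apply/eqP; rewrite eq_le outer_content_le //=; apply: lb_le_inf; first by exists 0.
by move=> w Aw; exact: inner_sums_le_outer_sums (inner_sums0 _) Aw.
Qed.

Theorem theorem2p1 (R : realType) (E : vectType R) (dot : {dot E for idfun})
    (F : {vspace E}) (Gamma S : set E) :
  let H := orthov dot F in
  let q := \dim H in
  let GammaF := dual_section dot F Gamma in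
  let V := lspan GammaF in
  let GammaFdual := dual_in dot V GammaF in
  let Vperp := orthov dot V in
  let Gammaperp := Gamma `&` [set` Vperp] in
  is_lattice fullv Gamma ->
  bounded_for dot S ->
  (forall g, GammaFdual g ->
    open_in dot Vperp g S /\ jordan_measurable_in dot Vperp g S) ->
  (fun eps : R => (lattice_count dot F Gamma S eps)%:R : R)
    ~_(0^'+)
  (fun eps : R => eps ^- q / covol dot Vperp Gammaperp *
    \sum_(g \in GammaFdual) vol_in dot Vperp g S).
Proof.
move=> H q GammaF V GammaFdual Vperp Gammaperp lL [M SM] hS.
pose G0 := [set g | GammaFdual g /\ exists2 x, S x & x - g \in Vperp].
have fG0 : finite_set G0.
  apply: sub_finite_set (dual_section_finite dot F lL M) => g [Lg [x Sx xg]].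
  split=> //; apply: le_trans (SM x Sx).
  have gV : g \in V by case: Lg.
  have xgg : dot (x - g) g = 0 by move/orthP: xg; apply.
  have -> : dot x x = dot g g + dot (x - g) (x - g).
    rewrite -[x in LHS](subrK g); move: (x - g) xgg => w wg.
    by rewrite linearDl /= !linearDr /= [dot g w]dotC wg addr0 add0r addrC.
  by rewrite lerDl dot_ge0.
pose Gs := fset_set G0.
have GsP g : g \in Gs -> G0 g by rewrite in_fset_set // inE.
have emptychart g : ~ G0 g -> GammaFdual g -> chart dot Vperp g @^-1` S = set0.
  move=> nG Lg; apply/seteqP; split=> // t St; apply: nG; split=> //.
  exists (chart dot Vperp g t) => //; rewrite /chart addrC addKr.
  exact: comb_mem (onb_basis dot Vperp).
have sumE : \sum_(g \in GammaFdual) vol_in dot Vperp g S =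
    \sum_(g <- Gs) vol_in dot Vperp g S.
  rewrite -(fsbig_widen G0) ?fsbig_finite //; first by move=> g [].
  by move=> g /= [Lg nG]; rewrite /vol_in emptychart // outer_content0.
set sigma := \sum_(g \in _) _ in sumE *.
have cntE eps : 0 < eps ->
    (lattice_count dot F Gamma S eps)%:R =
      \sum_(g <- Gs) (cnt (fiber dot F Gamma S eps g))%:R :> R.
  move=> e0; rewrite -natr_sum; congr _%:R.
  have cov y : (dilation dot F eps @` S `&` Gamma) y ->
      exists2 g, g \in Gs & fiber dot F Gamma S eps g y.
    move=> [[x Sx xy] Ly].
    have [g Lg yg] := fiber_of dot F Ly.
    exists g; last by split=> //; split => //; exists x.
    rewrite in_fset_set // inE; split=> //; exists x => //.
    have -> : x - g = (y - g) - (dilation dot F eps x - x).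
      by rewrite xy opprB [RHS]addrC addrA subrK.
    rewrite memvB //; apply: (subvP (H_sub_W dot F Gamma)); exact: dilation_subH.
  have ffib g : g \in Gs -> finite_set (fiber dot F Gamma S eps g).
    move=> /GsP[Lg _]; have [_ jS] := hS g Lg.
    by have [+ _] := fiber_cnt_cvg lL Lg jS; exact.
  apply/eqP; rewrite eqn_leq; apply/andP; split.
    exact: cnt_cover.
  apply: cnt_packing => //.
  - have : finite_set (\bigcup_(g in [set` Gs]) fiber dot F Gamma S eps g).
      by apply: bigcup_finite => // g gs; exact: ffib.
    by apply: sub_finite_set => y /cov[g gG yg]; exists g.
  - by move=> g _ y [].
  - move=> g g' y /GsP[[gV _] _] /GsP[[g'V _] _] [_ yg] [_ yg'].
    apply/eqP; rewrite -subr_eq0; apply/eqP; apply: (@orthov_cap0 _ _ dot V).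
      exact: memvB.
    have -> : g - g' = (y - g') - (y - g) by rewrite opprB [RHS]addrC addrA subrK.
    exact: memvB.
have lim : eps ^+ q * (lattice_count dot F Gamma S eps)%:R @[eps --> 0^'+] -->
    sigma / covol dot Vperp Gammaperp.
  have H1 : \sum_(g <- Gs) (if g \in Gs
        then eps ^+ q * (cnt (fiber dot F Gamma S eps g))%:R else 0)
      @[eps --> 0^'+] --> \sum_(g <- Gs) (if g \in Gs
        then vol_in dot Vperp g S / covol dot Vperp Gammaperp else 0).
    apply: cvg_sumr => g; case: ifPn => gG; last exact: cvg_cst.
    have [Lg _] := GsP g gG; have [_ jS] := hS g Lg.
    by have [_] := fiber_cnt_cvg lL Lg jS.
  rewrite sumE mulr_suml [X in _ --> X]big_seq big_mkcond /=.
  apply: cvg_trans H1; apply: near_eq_cvg; near=> eps.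
  have e0 : 0 < eps by near: eps; exact: nbhs_right_gt.
  by rewrite cntE // mulr_sumr [RHS]big_seq [RHS]big_mkcond.
set c := sigma / _ in lim.
have cov0 : 0 < covol dot Vperp Gammaperp.
  have [b bL ->] := covol_cellvol dot (orth_section_lattice dot F lL).
  by have [] := cell_jordan (coordmx_unit (onb_basis dot Vperp) bL.1).
apply/eqaddoP => eta eta0.
have [c0|c0] := eqVneq c 0.
  (* all the volumes vanish, so all the slices of S are empty and the count is
     eventually 0, as the equivalence to 0 requires *)
  have vol0 g : g \in Gs -> vol_in dot Vperp g S = 0.
    have s0 : \sum_(g <- Gs) vol_in dot Vperp g S = 0.
      by move/eqP: c0; rewrite /c sumE mulf_eq0 invr_eq0 (gt_eqF cov0) orbF => /eqP.
    move=> gG; apply/eqP; move/eqP: s0.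
    rewrite big_seq psumr_eq0 => [/allP/(_ g gG)|g' g'G].
      by rewrite gG.
    have [Lg _] := GsP g' g'G; have [_ [bA _]] := hS g' Lg.
    exact: inner_sums_le_outer_content bA (inner_sums0 _).
  near=> eps.
  have e0 : 0 < eps by near: eps; exact: nbhs_right_gt.
  have -> : ((fun eps : R => (lattice_count dot F Gamma S eps)%:R : R) -
     (fun eps : R => eps ^- q / covol dot Vperp Gammaperp * sigma)) eps =
     (lattice_count dot F Gamma S eps)%:R - eps ^- q * c.
    by rewrite fctE /c; congr (_ - _); rewrite mulrAC mulrA.
  rewrite c0 mulr0 subr0 cntE // big_seq big1 ?normr0 ?mulr_ge0 ?(ltW eta0) // => g gG.
  have [Lg [x Sx xg]] := GsP g gG; have [oA [bA _]] := hS g Lg.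
  have := outer_content_open_gt0 oA bA; rewrite -/(vol_in dot Vperp g S) vol0 // ltxx.
  have eV := onb_basis dot Vperp.
  move=> /(_ _)/negP; case=> //; exists (\row_i coord (onb dot Vperp) i (x - g)).
  by rewrite /preimage /= /chart -/(comb _ _) -comb_coord // addrC subrK.
have ec : 0 < eta * `|c| by rewrite mulr_gt0 // normr_gt0.
near=> eps.
have e0 : 0 < eps by near: eps; exact: nbhs_right_gt.
have eq0 : 0 < eps ^- q by rewrite invr_gt0 exprn_gt0.
have -> : ((fun eps : R => (lattice_count dot F Gamma S eps)%:R : R) -
   (fun eps : R => eps ^- q / covol dot Vperp Gammaperp * sigma)) eps =
   eps ^- q * (eps ^+ q * (lattice_count dot F Gamma S eps)%:R - c).
  rewrite fctE /c mulrBr mulrA mulVf ?mul1r ?gt_eqF ?exprn_gt0 //.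
  by congr (_ - _); rewrite mulrAC mulrA.
have -> : eps ^- q / covol dot Vperp Gammaperp * sigma = eps ^- q * c.
  by rewrite /c mulrAC mulrA.
rewrite !(normrM (eps ^- q)) (gtr0_norm eq0) mulrCA ler_pM2l // distrC.
by near: eps; move/cvgrPdist_le: lim; exact.
Unshelve. all: by end_near.
Qed.
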